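(* Let $\mathbb{B}_n$ be the Poincaré ball model of the $n$-dimensional hyperbolic space, $n\ge 2$, with $\rho(x)=\ln\frac{1+|x|}{1-|x|}$ the geodesic distance from $x$ to $0$. (a) Suppose $p\in(1,n)$ and $\beta<n-p$. Then there exists $c>0$ such that for every $f\in C_0^\infty(\mathbb{B}_n)$, $$\int_{\mathbb{B}_n}\frac{|\nabla_gf|_g^p}{\rho^\beta}\,dV_g\ge\left(\frac{n-p-\beta}{p}\right)^p\int_{\mathbb{B}_n}\frac{|f|^p}{\rho^{p+\beta}}\,dV_g+3c(n-1)\left(\frac{n-p-\beta}{p}\right)^{p-1}\int_{\mathbb{B}_n}\frac{|f|^p}{\rho^{p+\beta-2}}\,dx .$$ (b) Let $B_1(0)=\{x\in\mathbb{B}_n:\rho(x)<1\}$ be the geodesic unit ball centered at $0$. There exists a constant $c>0$ such that for every $p>1$ and every $f\in C_0^\infty(B_1(0))$, $$\int_{B_1(0)}\frac{|\nabla_gf|_g^p}{\rho^{n-p}}\,dV_g\ge\left(\frac{p-1}{p}\right)^p\int_{B_1(0)}\frac{|f|^p}{\rho^n(\ln\frac1\rho)^p}\,dV_g+3c(n-1)\left(\frac{p-1}{p}\right)^{p-1}\int_{B_1(0)}\frac{|f|^p}{\rho^{n-2}(\ln\frac1\rho)^{p-1}}\,dx .$$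
   Context: $\mathbb{B}_n=\{x\in\mathbb{R}^n:|x|<1\}$ is equipped with the hyperbolic metric $g=\left(\frac{2}{1-|x|^2}\right)^2\sum_i dx_i^2$ (constant sectional curvature $-1$). Its volume measure is $dV_g=\left(\frac{2}{1-|x|^2}\right)^ndx$, where $dx$ is Lebesgue measure. $\nabla_g=\left(\frac{1-|x|^2}{2}\right)^2\nabla$ is the Riemannian gradient, with length $|\nabla_gf|_g=\frac{1-|x|^2}{2}|\nabla f|$ ($\nabla$ and $|\cdot|$ Euclidean). *)

(* Defs.v *)
From HB Require Import structures.
From mathcomp Require Import all_boot all_order all_algebra.
From mathcomp Require Import all_classical all_reals all_analysis.
From mathcomp Require Import measurable_realfun ring lra.

Set Implicit Arguments.
Unset Strict Implicit.
Unset Printing Implicit Defensive.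

Import Order.TTheory GRing.Theory Num.Theory.
Import numFieldNormedType.Exports.

Local Open Scope classical_set_scope.
Local Open Scope ring_scope.

(* 'rV[R]_n carries the sigma-algebra generated by the n coordinates, i.e.
   its Borel sigma-algebra. *)
Section rV_measurable.
Context (R : realType) (n : nat).

Let coor (i : 'I_n) (x : 'rV[R]_n) : measurableTypeR R := x ord0 i.

Let rV_measurable0 : g_sigma_preimage coor set0.
Proof. exact: sigma_algebra0. Qed.

Let rV_measurableC A : g_sigma_preimage coor A -> g_sigma_preimage coor (~` A).
Proof. exact: sigma_algebraC. Qed.

Let rV_measurable_bigcup (F : (set _)^nat) :
  (forall i, g_sigma_preimage coor (F i)) ->
  g_sigma_preimage coor (\bigcup_i F i).
Proof. exact: sigma_algebra_bigcup. Qed.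

HB.instance Definition _ := @isMeasurable.Build default_measure_display
  'rV[R]_n (g_sigma_preimage coor)
  rV_measurable0 rV_measurableC rV_measurable_bigcup.

Lemma measurable_coord (i : 'I_n) :
  measurable_fun [set: 'rV[R]_n] (fun x : 'rV[R]_n => x ord0 i).
Proof.
move=> _ Y mY; rewrite setTI; apply: sub_sigma_algebra => /=.
rewrite -bigcup_seq/=; exists i => /=; first by rewrite mem_index_enum.
by exists Y => //; rewrite setTI.
Qed.

Lemma measurable_fun_rVP d (T : measurableType d) (f : T -> 'rV[R]_n) :
  measurable_fun [set: T] f <->
  forall i, measurable_fun [set: T] (fun t => f t ord0 i).
Proof.
split=> [mf i|mf].
  exact: (measurableT_comp (measurable_coord i) mf).
suff sub : g_sigma_preimage coor `<=` [set A | measurable (f @^-1` A)].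
  by move=> _ A mA; rewrite setTI; exact: sub.
apply: smallest_sub.
  split => /=.
  - by rewrite preimage_set0.
  - by move=> A /= mA; rewrite setTD preimage_setC; exact: measurableC.
  - by move=> F /= mF; rewrite preimage_bigcup; exact: bigcup_measurable.
rewrite -bigcup_seq => A [i _ [B mB <-]] /=.
have := mf i measurableT B mB.
by rewrite !setTI.
Qed.

End rV_measurable.

(* Lebesgue measure on 'rV[R]_n: the n-fold product of the Lebesgue measure of
   the real line, transported along (a, x) |-> row_mx a x. *)
Section rV_lebesgue_step.
Context (R : realType) (n : nat).
Variable mu : {sigma_finite_measure set 'rV[R]_n -> \bar R}.

Definition rV_cons (p : measurableTypeR R * 'rV[R]_n) : 'rV[R]_n.+1 :=
  row_mx (const_mx p.1 : 'rV_1) p.2.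

Lemma rV_cons0 p : rV_cons p ord0 ord0 = p.1.
Proof.
have -> : ord0 = lshift n (ord0 : 'I_1) :> 'I_(1 + n) by exact/val_inj.
by apply: etrans (row_mxEl _ _ _ _) _; rewrite mxE.
Qed.

Lemma rV_consS p i : rV_cons p ord0 (lift ord0 i) = p.2 ord0 i.
Proof.
have -> : lift ord0 i = rshift 1 i :> 'I_(1 + n) by exact/val_inj.
exact: row_mxEr.
Qed.

Lemma measurable_rV_cons : measurable_fun [set: _] rV_cons.
Proof.
apply/measurable_fun_rVP => i; case: (unliftP ord0 i) => [j ->|->].
  under [X in measurable_fun _ X]eq_fun do rewrite rV_consS.
  exact: (measurableT_comp (measurable_coord j) measurable_snd).
under [X in measurable_fun _ X]eq_fun do rewrite rV_cons0.
exact: measurable_fst.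
Qed.

Definition rV_lebesgue_step : set 'rV[R]_n.+1 -> \bar R :=
  pushforward (@lebesgue_measure R \x mu)%E rV_cons.

Let step0 : rV_lebesgue_step set0 = 0%E.
Proof. by rewrite /rV_lebesgue_step /pushforward preimage_set0 measure0. Qed.

Let step_ge0 A : (0 <= rV_lebesgue_step A)%E.
Proof.
by rewrite /rV_lebesgue_step /pushforward; exact: (measure_ge0 (_ \x _)%E).
Qed.

Let step_sigma_additive : semi_sigma_additive rV_lebesgue_step.
Proof.
move=> F mF tF mUF; rewrite /rV_lebesgue_step /pushforward preimage_bigcup.
apply: measure_semi_sigma_additive.
- by move=> k; rewrite -[X in measurable X]setTI; exact: measurable_rV_cons.
- apply/trivIsetP => /= i j _ _ ij; rewrite -preimage_setI.
  by move/trivIsetP : tF => /(_ _ _ _ _ ij) ->//; rewrite preimage_set0.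
- rewrite -preimage_bigcup -[X in measurable X]setTI.
  exact: measurable_rV_cons.
Qed.

HB.instance Definition _ := isMeasure.Build _ _ _ rV_lebesgue_step
  step0 step_ge0 step_sigma_additive.

Let uncons (x : 'rV[R]_n.+1) : measurableTypeR R * 'rV[R]_n :=
  (x ord0 ord0, \row_i x ord0 (lift ord0 i)).

Let consK : cancel rV_cons uncons.
Proof.
move=> [a x]; rewrite /uncons rV_cons0; congr pair.
by apply/rowP => i; rewrite mxE rV_consS.
Qed.

Let measurable_uncons : measurable_fun [set: _] uncons.
Proof.
apply/measurable_fun_pairP; split; first exact: (measurable_coord ord0).
apply/measurable_fun_rVP => i.
rewrite /comp/=; under [X in measurable_fun _ X]eq_fun do rewrite mxE.
exact: measurable_coord.
Qed.

Let step_sigma_finite : sigma_finite setT rV_lebesgue_step.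
Proof.
have /sigma_finiteP[F [FT ndF Foo]] := sigma_finiteT (@lebesgue_measure R).
have /sigma_finiteP[G [GT ndG Goo]] := sigma_finiteT mu.
have FGT : [set: measurableTypeR R * 'rV[R]_n] = \bigcup_k (F k `*` G k).
  rewrite -setXTT FT GT predeqE => -[x y]; split.
    move=> [/= [k _ Fx] [l _ Gy]]; exists (maxn k l) => //; split.
    - by move: x Fx; exact/subsetPset/ndF/leq_maxl.
    - by move: y Gy; exact/subsetPset/ndG/leq_maxr.
  by move=> [k _ []/= ? ?]; split; exists k.
exists (fun k => uncons @^-1` (F k `*` G k)).
  by rewrite -preimage_bigcup -FGT preimage_setT.
move=> k; have [mF Fk] := Foo k; have [mG Gk] := Goo k; split.
  by rewrite -[X in measurable X]setTI; apply: measurable_uncons => //;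
    exact: measurableX.
rewrite /rV_lebesgue_step /pushforward -comp_preimage.
rewrite (_ : uncons \o rV_cons = id); last first.
  by apply/funext => p /=; rewrite consK.
by rewrite preimage_id product_measure1E// lte_mul_pinfty// ge0_fin_numE.
Qed.

HB.instance Definition _ := Measure_isSigmaFinite.Build _ _ _ rV_lebesgue_step
  step_sigma_finite.

End rV_lebesgue_step.

Fixpoint rV_lebesgue (R : realType) (n : nat) :
    {sigma_finite_measure set 'rV[R]_n -> \bar R} :=
  match n with
  | 0%N => \d_(0 : 'rV[R]_0)
  | n'.+1 => rV_lebesgue_step (rV_lebesgue R n')
  end.

Lemma rV_lebesgue_box (R : realType) (n : nat) (A : 'I_n -> set R) :
  (forall i, measurable (A i)) ->
  rV_lebesgue R n [set x | forall i, A i (x ord0 i)] =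
  (\prod_(i < n) lebesgue_measure (A i))%E.
Proof.
elim: n A => [|n IHn] A mA.
  rewrite big_ord0 /= diracE mem_set//= => -[]//.
rewrite big_ord_recl -IHn => [|i]; last exact: mA.
rewrite /= /rV_lebesgue_step /pushforward -product_measure1E.
- congr (_ _); apply/seteqP; split=> [[a x] /= H|[a x] /= [Ha Hx] i].
    split; first by have := H ord0; rewrite rV_cons0.
    by move=> i; have := H (lift ord0 i); rewrite rV_consS.
  by case: (unliftP ord0 i) => [j ->|->]; rewrite ?rV_consS ?rV_cons0.
- exact: mA.
- have : measurable (\bigcap_(i in [set: 'I_n])
      ((fun x : 'rV[R]_n => x ord0 i) @^-1` A (lift ord0 i))).
    apply: fin_bigcap_measurable => // i _; rewrite -[X in measurable X]setTI.
    exact: measurable_coord.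
  congr measurable.
  by apply/seteqP; split=> x /= H i => [|_]; exact: H.
Qed.

Definition enorm (R : realType) (n : nat) (v : 'rV[R]_n) : R :=
  Num.sqrt (\sum_(i < n) v ord0 i ^+ 2).

Definition partial (R : realType) (n : nat) (i : 'I_n) (f : 'rV[R]_n -> R) :
    'rV[R]_n -> R := fun x => 'D_(delta_mx ord0 i) f x.

Definition grad (R : realType) (n : nat) (f : 'rV[R]_n -> R) (x : 'rV[R]_n) :
    'rV[R]_n := \row_(i < n) partial i f x.

(* All iterated partial derivatives exist and are continuous on R^n. *)
Definition smooth (R : realType) (n : nat) (f : 'rV[R]_n -> R) : Prop :=
  forall s : seq 'I_n, let g := foldr (@partial R n) f s in
    continuous g /\
    forall (i : 'I_n) (x : 'rV[R]_n), derivable g x (delta_mx ord0 i).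

(* f in C_0^oo(Omega), identified with its extension by zero to R^n. *)
Definition test_function (R : realType) (n : nat) (Omega : set 'rV[R]_n)
    (f : 'rV[R]_n -> R) : Prop :=
  [/\ smooth f, compact (closure [set x | f x != 0])
    & closure [set x | f x != 0] `<=` Omega].

Definition hball (R : realType) (n : nat) : set 'rV[R]_n :=
  [set x | enorm x < 1].

(* The metric g is (conf x)^2 times the Euclidean one. *)
Definition conf (R : realType) (n : nat) (x : 'rV[R]_n) : R :=
  2 / (1 - enorm x ^+ 2).

(* The g-length of the tangent vector v at x. *)
Definition glength (R : realType) (n : nat) (x v : 'rV[R]_n) : R :=
  conf x * enorm v.

Definition hgrad (R : realType) (n : nat) (f : 'rV[R]_n -> R) (x : 'rV[R]_n) :
    'rV[R]_n := ((1 - enorm x ^+ 2) / 2) ^+ 2 *: grad f x.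

Definition rho (R : realType) (n : nat) (x : 'rV[R]_n) : R :=
  ln ((1 + enorm x) / (1 - enorm x)).

Definition hball1 (R : realType) (n : nat) : set 'rV[R]_n :=
  [set x | hball x /\ rho x < 1].

Lemma enormZ (R : realType) (n : nat) (a : R) (v : 'rV[R]_n) :
  enorm (a *: v) = `|a| * enorm v.
Proof.
rewrite /enorm -sqrtr_sqr -sqrtrM ?sqr_ge0// mulr_sumr.
by congr Num.sqrt; apply: eq_bigr => i _; rewrite mxE exprMn.
Qed.

Lemma enorm_ge0 (R : realType) (n : nat) (v : 'rV[R]_n) : 0 <= enorm v.
Proof. exact: sqrtr_ge0. Qed.

Lemma hball_gt0 (R : realType) (n : nat) (x : 'rV[R]_n) :
  hball x -> 0 < 1 - enorm x ^+ 2.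
Proof. by rewrite /hball/= => x1; rewrite subr_gt0 expr_lt1// enorm_ge0. Qed.

Lemma glength_hgrad (R : realType) (n : nat) (f : 'rV[R]_n -> R)
    (x : 'rV[R]_n) :
  hball x -> glength x (hgrad f x) = (1 - enorm x ^+ 2) / 2 * enorm (grad f x).
Proof.
move=> /hball_gt0 x1.
rewrite /glength /hgrad /conf enormZ normrX gtr0_norm ?divr_gt0//.
by field; rewrite gt_eqF.
Qed.

Section hyperbolic_volume.
Context (R : realType) (n : nat).

Lemma measurable_enorm : measurable_fun [set: 'rV[R]_n] (@enorm R n).
Proof.
apply: (@measurableT_comp _ _ _ _ _ _ (@Num.sqrt R)).
  by apply: continuous_measurable_fun; exact: sqrt_continuous.
by apply: measurable_sum => i; apply: measurable_funX; exact: measurable_coord.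
Qed.

Lemma measurable_hball : measurable (@hball R n).
Proof.
have -> : @hball R n = [set: 'rV[R]_n] `&` @enorm R n @^-1` `]-oo, 1[.
  by apply/seteqP; split => x /=; rewrite in_itv/=; [|case].
by apply: measurable_enorm => //; exact: measurable_itv.
Qed.

Lemma conf_ge0 (x : 'rV[R]_n) : hball x -> 0 <= conf x.
Proof. by move=> /hball_gt0 x1; rewrite divr_ge0// ltW. Qed.

Lemma measurable_conf : measurable_fun (@hball R n) (@conf R n).
Proof.
apply: (eq_measurable_fun (fun x : 'rV[R]_n => 2 * (1 - enorm x ^+ 2) `^ (-1))).
  by move=> x /[!inE] /hball_gt0 x1; rewrite powR_inv1// ltW.
apply: measurable_funTS; apply: measurable_funM => //.
apply: (measurableT_comp (measurable_powR _)).
apply: measurable_funB => //; apply: measurable_realfun.measurable_funX; exact: measurable_enorm.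
Qed.

(* dV_g, as a measure on R^n concentrated on the ball. *)
Definition hvol (A : set 'rV[R]_n) : \bar R :=
  (\int[rV_lebesgue R n]_(x in A `&` @hball R n) (conf x ^+ n)%:E)%E.

Let hvol0 : hvol set0 = 0%E.
Proof. by rewrite /hvol set0I integral_set0. Qed.

Let hvol_ge0 A : (0 <= hvol A)%E.
Proof.
by apply: integral_ge0 => x [_ x1]; rewrite lee_fin exprn_ge0// conf_ge0.
Qed.

Let hvol_sigma_additive : semi_sigma_additive hvol.
Proof.
move=> F mF tF mUF; rewrite /hvol setI_bigcupl; apply: cvg_toP.
  apply: ereal_nondecreasing_is_cvgn => k l kl.
  by apply: lee_sum_nneg_natr => // i _ _; exact: hvol_ge0.
rewrite ge0_integral_bigcup//=.
- by move=> k; apply: measurableI => //; exact: measurable_hball.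
- rewrite -setI_bigcupl; apply/measurable_EFinP.
  apply: (@measurable_funS _ _ _ _ (@hball R n)) => //.
    exact: measurable_hball.
  by apply: measurable_funX; exact: measurable_conf.
- by move=> x [k _ [_ x1]]; rewrite lee_fin exprn_ge0// conf_ge0.
- exact: trivIset_setIr.
Qed.

HB.instance Definition _ := isMeasure.Build _ _ _ hvol
  hvol0 hvol_ge0 hvol_sigma_additive.

End hyperbolic_volume.

(* Main.v *)
(* The inequality only involves |f| and |x|, and the radial derivative is at
   most the full gradient, so it is enough to prove it on every ray.  On a ray,
   with r = |x|, l = rho and conf = 2 / (1 - r^2), it follows from Young's
   inequality and integrating the derivative of |u|^p t, where
     t = C^(p-1) (sinh l)^(n-1) q(l),   sinh l = r conf,
   and q = l^(1-p-beta) in (a), q = l^(1-n) (ln(1/l))^(1-p) in (b).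
   Differentiating (sinh l)^(n-1) produces (n-1) coth l, and the bound
   coth l >= 1/l + l conf^(-n) yields the second term with c = 1/3.
   The boundary term at the origin is -|u|^p t <= 0, so the singularity of the
   weights there is harmless.
   Polar coordinates are replaced by the identity
     int F(x) dx = int_(1/2 <= |y| <= 1) |y|^-1 int_0^oo t^(n-1) F(t y) dt dy,
   obtained from Tonelli's theorem and the behaviour of Lebesgue measure under
   dilations by inserting |x|^-1 int 1_(|x| <= t <= 2|x|) dt = 1. *)
Require Import Defs.
From mathcomp Require Import all_boot all_order all_algebra.
From mathcomp Require Import all_classical all_reals all_analysis.
From mathcomp Require Import measurable_realfun ring lra.

Set Implicit Arguments.
Unset Strict Implicit.
Unset Printing Implicit Defensive.

Import Order.TTheory GRing.Theory Num.Theory.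
Import numFieldNormedType.Exports.

Local Open Scope classical_set_scope.
Local Open Scope ring_scope.

(** The slope that makes Young's inequality sharp is C eta(l) = -phi'(l)/phi(l), where phi is the
    formal extremal: phi = l^(-C), eta = 1/l in (a), and phi = (ln(1/l))^C, eta = 1/(l ln(1/l)) in
    (b). With wt the weight of the gradient, both cases reduce to the flat identity (l^(n-1) q)' = p
    C l^(n-1) P for q = eta^(p-1) wt and P = eta^p wt, so one argument serves both. Curvature enters
    only through coth l - 1/l. The factor conf^(-n) in the bound for coth is there because the
    second integral is taken against dx and not dV_g. It also leaves room: near the origin coth l -
    1/l behaves like l/3, while conf >= 2 and n >= 2 give l conf^(-n) <= l/4. Integrals may be
    infinite and the derivative of |u|^p t has no sign, so nothing is subtracted globally: the
    inequality is proved on compact pieces of a ray and passed to the limit. No measure on the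
    sphere is needed, since both sides are averaged over directions with the same nonnegative
    kernel. *)

(** * Borel sets and continuous functions on row vectors *)

Section borel.
Context (R : realType) (n : nat).

Lemma measurable_rV_ball (x : 'rV[R]_n) (e : R) : 0 < e ->
  measurable (ball x e).
Proof.
move=> e0.
have -> : ball x e = \bigcap_(i in [set: 'I_n])
    ((fun y : 'rV[R]_n => y ord0 i) @^-1` ball (x ord0 i) e).
  apply/seteqP; split => y.
    by case=> _ H i _; exact: H.
  by move=> H; split=> // i j; rewrite (ord1 i); exact: H.
apply: fin_bigcap_measurable => // i _; rewrite -[X in measurable X]setTI.
by apply: measurable_coord => //; exact: measurable_ball.
Qed.

(** Balls are boxes, and an open set is the countable union of the balls with rational centre and
    radius 1/(m+1) that it contains. This links the coordinate sigma-algebra to the topology. *)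
Lemma measurable_rV_open (U : set 'rV[R]_n) : open U -> measurable U.
Proof.
move=> oU.
pose B (k : 'rV[rat]_n * nat) : set 'rV[R]_n :=
  ball (map_mx ratr k.1 : 'rV[R]_n) (k.2.+1%:R^-1 : R).
have -> : U = \bigcup_(k in [set k | B k `<=` U]) B k.
  apply/seteqP; split=> x; last by move=> [k /= kU] /kU.
  move=> Ux; have := open_nbhs_nbhs (conj oU Ux).
  rewrite -nbhs_ballE => -[e /= e0 eU].
  have e20 : 0 < e / 2 by rewrite divr_gt0.
  have [m _ /(_ _ (leqnn m)) /= me] := near_infty_natSinv_lt (PosNum e20).
  have H i : {q : rat | ball (x ord0 i) m.+1%:R^-1 (ratr q)}.
    have : x ord0 i - m.+1%:R^-1 < x ord0 i + m.+1%:R^-1.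
      by rewrite ltrD2l gtrN// invr_gt0.
    move=> /rat_in_itvoo/cid[q]; rewrite in_itv/= => /andP[q1 q2]; exists q.
    by rewrite /ball/= ltr_distl ltrBlDr q2 -ltrBlDr q1.
  exists (\row_i sval (H i), m); last first.
    split=> [|i j /=]; first by rewrite invr_gt0.
    by rewrite (ord1 i) !mxE; apply: ball_sym; exact: (svalP (H j)).
  move=> y [/= _ yB]; apply: eU; split=> // i j; rewrite (ord1 i).
  have h1 : ball (x ord0 j) m.+1%:R^-1 (ratr (sval (H j)) : R)
    by exact: (svalP (H j)).
  have h2 := yB ord0 j; rewrite !mxE in h2; move: h1 h2; rewrite /ball/=.
  move=> /lt_trans/(_ me) h1 /lt_trans/(_ me) h2.
  by rewrite (le_lt_trans (ler_distD (ratr (sval (H j))) _ _))// (splitr e)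
    ltrD.
rewrite bigcup_mkcond; apply: countable_bigcupT_measurable => [|k];
  first exact: countableP.
case: ifP => // _; apply: measurable_rV_ball; by rewrite invr_gt0.
Qed.

Lemma continuous_rV_measurable (f : 'rV[R]_n -> R) :
  continuous f -> measurable_fun setT f.
Proof.
move=> /continuousP cf; apply: (measurability _ (RGenOpens.measurableE R)).
move=> _ [_ [a [b ->] <-]]; rewrite setTI; apply: measurable_rV_open.
exact/cf/interval_open.
Qed.

End borel.

(** * Directional derivatives of functions with continuous partial derivatives *)

Section directional_derivative.
Context (R : realType) (n : nat).
Implicit Types (f : 'rV[R]_n -> R) (v w x : 'rV[R]_n).

Lemma is_derive_line f v x (s : R) :
  derivable f (s *: v + x) v ->
  is_derive s 1 (fun t : R => f (t *: v + x)) ('D_v f (s *: v + x)).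
Proof.
move=> df.
have E : (fun h : R => h^-1 *:
  (((fun t : R => f (t *: v + x)) \o shift s) (h *: 1) - f (s *: v + x)))
   = (fun h => h^-1 *: ((f \o shift (s *: v + x)) (h *: v) - f (s *: v + x))).
  by apply/funext => h /=; rewrite /shift/= -[h *: 1]/(h * 1) mulr1 scalerDl
    addrA.
by split; rewrite /derivable /derive E.
Qed.

Lemma derive_scale f (a : R) v x : derivable f x v ->
  derivable f x (a *: v) /\ 'D_(a *: v) f x = a * 'D_v f x.
Proof.
move=> df; have [->|a0] := eqVneq a 0.
  by rewrite scale0r mul0r; split; [exact: derivable0|exact: derive0].
have df0 : derivable f (0 *: v + x) v by rewrite scale0r add0r.
have H := is_derive_line df0.
have H1 : is_derive (0:R) 1 (fun t : R => a * t) a.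
  by apply: is_derive_eq; rewrite /GRing.scale/=; lra.
have H' : is_derive (a * 0) 1 (fun t : R => f (t *: v + x)) ('D_v f x).
  by rewrite mulr0; move: H; rewrite scale0r add0r.
have := is_derive1_comp (f := fun t : R => f (t *: v + x))
  (g := fun t => a * t).
move=> /(_ _ _ _ H' H1).
have E : (fun h : R => h^-1 *:
  ((((fun t : R => f (t *: v + x)) \o (fun t => a * t)) \o shift 0) (h *: 1) -
  f ((a * 0) *: v + x)))
   = (fun h => h^-1 *: ((f \o shift x) (h *: (a *: v)) - f x)).
  by apply/funext => h /=; rewrite /shift/= -[h *: 1]/(h * 1) mulr1 mulr0
    scale0r add0r addr0 scalerA mulrC.
case=> d1 d2; split.
  by move: d1; rewrite /derivable E.
by move: d2; rewrite /derive E => ->; exact: mulrC.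
Qed.

(* Mean value theorem in the direction w, between x + h v and x + h v + h w. *)
Lemma derive_add f v w :
  (forall x, derivable f x v) -> (forall x, derivable f x w) ->
  continuous (fun x => 'D_w f x) ->
  forall x, derivable f x (v + w) /\ 'D_(v + w) f x = 'D_v f x + 'D_w f x.
Proof.
move=> dv dw cw x.
suff H : h^-1 *: ((f \o shift x) (h *: (v + w)) - f x) @[h --> (0:R)^']
    --> 'D_v f x + 'D_w f x.
  by split; [apply/cvg_ex; eexists; exact: H|exact/cvg_lim].
have -> : (fun h : R => h^-1 *: ((f \o shift x) (h *: (v + w)) - f x)) =
  (fun h => h^-1 *: ((f \o shift x) (h *: v) - f x) +
            h^-1 *: (f (h *: w + (h *: v + x)) - f (h *: v + x))).
  apply/funext => h /=; rewrite /shift/= -scalerDr; congr (_ *: _).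
  by rewrite scalerDr (addrC (h *: v)) -addrA; ring.
apply: cvgD; first exact: dv.
apply/cvgrPdist_lt => e e0.
have /cvgrPdist_lt/(_ e e0) := cw x.
rewrite -nbhs_ballE /= => -[d /= d0 dB].
have M0 : 0 < `|v| + `|w| + 1 by rewrite ltr_wpDl.
near=> h.
have h0 : h != 0 by near: h; exact: nbhs_dnbhs_neq.
have [t /andP[t0 t1] ->] : exists2 t : R, 0 <= t <= 1 &
    h^-1 *: (f (h *: w + (h *: v + x)) - f (h *: v + x)) =
    'D_w f ((t * h) *: w + (h *: v + x)).
  pose g (t : R) := f ((t * h) *: w + (h *: v + x)).
  have dg (s : R) : is_derive s 1 g (h * 'D_w f ((s * h) *: w + (h *: v + x))).
    have [d1 d2] := derive_scale h (dw ((s * h) *: w + (h *: v + x))).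
    rewrite -d2; move: d1; rewrite -scalerA => /is_derive_line.
    by under eq_fun do rewrite scalerA.
  have [|t] := @MVT_segment R g (fun s => h *
    'D_w f ((s * h) *: w + (h *: v + x))) 0 1 ler01 (fun s _ => dg s).
    apply: continuous_subspaceT => s.
    by apply: differentiable_continuous; apply/derivable1_diffP;
      have [] := dg s.
  rewrite in_itv/= => t01; rewrite /g mul0r mul1r scale0r add0r subr0 mulr1 =>
    ->.
  by exists t => //; rewrite -[_ *: _]/(_ * _) mulKf.
apply: dB; rewrite -ball_normE /ball_/=.
have -> : x - ((t * h) *: w + (h *: v + x)) = - ((t * h) *: w + h *: v).
  by rewrite addrA opprD addrCA subrr addr0.
rewrite normrN (le_lt_trans (ler_normD _ _))// !mx_normZ normrM.
have hd : `|h| < d / (`|v| + `|w| + 1).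
  by near: h; apply: dnbhs0_lt; rewrite divr_gt0.
apply: le_lt_trans (_ : `|h| * (`|v| + `|w| + 1) < d); last first.
  by rewrite -ltr_pdivlMr.
rewrite (ger0_norm t0) mulrDr mulrDr mulr1 addrC -addrA lerD2l.
rewrite -[leLHS]addr0 lerD// -mulrA.
by rewrite ler_piMl// mulr_ge0.
Unshelve. all: end_near. Qed.

(** [smooth] speaks only of partial derivatives along coordinate axes, whereas rays need every
    direction. The vector is built up one coordinate at a time with [derive_add]. *)
Lemma derive_C1 f : (forall i x, derivable f x (delta_mx ord0 i)) ->
  (forall i, continuous (partial i f)) ->
  forall v, (forall x, derivable f x v) /\ forall x, 'D_v f x =
    \sum_(i < n) v ord0 i * partial i f x.
Proof.
move=> df cf v.
have Ev : v = \sum_(i < n) v ord0 i *: delta_mx ord0 i.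
  by rewrite [LHS]matrix_sum_delta big_ord1.
suff H : [/\ forall x, derivable f x (\sum_(i < n) v ord0 i *: delta_mx ord0 i),
   continuous (fun x => \sum_(i < n) v ord0 i * partial i f x) &
   forall x, 'D_(\sum_(i < n) v ord0 i *: delta_mx ord0 i) f x =
     \sum_(i < n) v ord0 i * partial i f x].
  by rewrite {1 2}Ev; case: H.
(* Continuity belongs to the invariant because [derive_add] needs it for the partial sum already
   built. *)
pose K (a : 'rV[R]_n) (b : 'rV[R]_n -> R) :=
  [/\ forall x, derivable f x a, continuous b & forall x, 'D_a f x = b x].
suff : K (\sum_(i < n) v ord0 i *: delta_mx ord0 i)
  (\sum_(i < n) (fun x => v ord0 i * partial i f x)).
  rewrite (_ : \sum_(i < n) (fun x => v ord0 i * partial i f x) =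
    fun x => \sum_(i < n) v ord0 i * partial i f x)//.
  by apply/funext => x; rewrite fct_sumE.
apply: (big_rec2 K) => [|i a b _ [da cb Da]].
  split=> [x||x]; [exact: derivable0|exact: cst_continuous|exact: derive0].
have H1 x := derive_scale (v ord0 i) (df i x).
have H2 := derive_add (fun x => (H1 x).1) da.
have cb' : continuous (fun x => 'D_a f x).
  by rewrite (_ : (fun x => _) = b)//; exact/funext.
split=> [x|x|x].
- by have [] := H2 cb' x.
- by apply: (@continuousD _ _ _ (fun x => v ord0 i * partial i f x) b);
  [apply: (@continuousM _ _ (fun=> v ord0 i) (partial i f));
  [exact: cst_continuous|exact: cf]|exact: cb].
- by have [_ ->] := H2 cb' x; rewrite (H1 x).2 Da.
Qed.

End directional_derivative.

(** * Lebesgue measure under dilations *)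

Section scaling.
Context (R : realType).
Local Notation leb := (@lebesgue_measure R).
Local Open Scope ereal_scope.

(** The image of Lebesgue measure under x -> t x, multiplied by t, gives each interval ]a, b] its
    length, so it is Lebesgue measure by uniqueness. *)
Lemma ge0_integral_lebesgue_scale (t : R) (f : R -> \bar R) : (0 < t)%R ->
  measurable_fun setT f -> (forall x, 0 <= f x) ->
  \int[leb]_x f x = t%:E * \int[leb]_x f (t * x)%R.
Proof.
move=> t0 mf f0.
pose phi (x : measurableTypeR R) : measurableTypeR R := (t * x)%R.
have mphi : measurable_fun setT phi.
  by apply: measurable_funM => //; exact: measurable_cst.
have tNN : (0 <= t)%R by exact: ltW.
pose m0 := mscale (NngNum tNN) (pushforward leb phi); pose m := m0 mphi.
have E A : measurable A -> leb A = m A.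
  apply: lebesgue_measure_unique => _ [[a b] _ <-] /=.
  rewrite /m /m0 /mscale/= /pushforward.
  have -> : phi @^-1` `]a, b]%classic = `](a / t)%R, (b / t)%R]%classic.
    apply/seteqP; split=> x /=; rewrite !in_itv/= /phi ltr_pdivrMr//
      ler_pdivlMr// mulrC //.
  rewrite !lebesgue_measure_itv/= !lte_fin ltr_pM2r ?invr_gt0//.
  case: ifPn => ab; last by rewrite mule0.
  by rewrite -!EFinB -EFinM; congr EFin; field; rewrite gt_eqF.
rewrite (eq_measure_integral m)//; last by move=> A mA _; exact: E.
rewrite ge0_integral_mscale//=; congr (_ * _).
by rewrite ge0_integral_pushforward.
Qed.

Lemma ge0_integral_rVS n (f : 'rV[R]_n.+1 -> \bar R) :
  measurable_fun setT f -> (forall x, 0 <= f x) ->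
  \int[rV_lebesgue R n.+1]_x f x =
  \int[leb]_a \int[rV_lebesgue R n]_x f (rV_cons (a, x)).
Proof.
move=> mf f0 /=.
rewrite /rV_lebesgue_step ge0_integral_pushforward//;
  last exact: measurable_rV_cons.
rewrite preimage_setT fubini_tonelli1//.
by apply: measurableT_comp => //; exact: measurable_rV_cons.
by move=> x; exact: f0.
Qed.

Lemma measurable_rV_scale n d (T : measurableType d) (g : T -> R)
  (h : T -> 'rV[R]_n) :
  measurable_fun setT g -> measurable_fun setT h ->
  measurable_fun setT (fun z => g z *: h z)%R.
Proof.
move=> mg /measurable_fun_rVP mh; apply/measurable_fun_rVP => i.
under [X in measurable_fun _ X]eq_fun do rewrite mxE.
by apply: measurable_funM.
Qed.

Lemma measurable_rV_scalel n (t : R) :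
  measurable_fun setT (fun x : 'rV[R]_n => t *: x)%R.
Proof. by apply: measurable_rV_scale => //; exact: measurable_cst. Qed.

(** Induction on the dimension: Tonelli splits off the first coordinate, which contributes one
    factor t. In dimension 0 the space is a point, fixed by every dilation. *)
Lemma ge0_integral_rV_scale n (t : R) (f : 'rV[R]_n -> \bar R) : (0 < t)%R ->
  measurable_fun setT f -> (forall x, 0 <= f x) ->
  \int[rV_lebesgue R n]_x f x = (t ^+ n)%:E *
    \int[rV_lebesgue R n]_x f (t *: x)%R.
Proof.
move=> t0; elim: n f => [|n IH] f mf f0.
  rewrite expr0 mul1e; apply: eq_integral => x _; congr f.
  by apply/rowP => -[].
rewrite (ge0_integral_rVS mf f0).
under eq_integral => a _.
  rewrite IH//; last first.
    by apply: measurableT_comp => //; apply: measurableT_comp;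
      [exact: measurable_rV_cons|exact: measurable_pair1].
  over.
have mF : measurable_fun setT (fun z : measurableTypeR R *
  'rV[R]_n => f (rV_cons (z.1, t *: z.2)%R)).
  apply: measurableT_comp => //; apply: measurableT_comp;
    first exact: measurable_rV_cons.
  apply/measurable_fun_pairP; split; first exact: measurable_fst.
  by apply: measurable_rV_scale; [exact: measurable_cst|exact: measurable_snd].
have mH := @measurable_fun_fubini_tonelli_F _ _ _ _ _ (rV_lebesgue R n) _ mF
  (fun=> f0 _).
rewrite /fubini_F/= in mH.
have H0 a : 0 <= \int[rV_lebesgue R n]_y f (rV_cons (a, t *: y)%R).
  by apply: integral_ge0.
have tn0 : (0 <= t ^+ n)%R by rewrite exprn_ge0// ltW.
rewrite ge0_integralZl//.
rewrite (ge0_integral_lebesgue_scale t0)// muleA -EFinM -exprSr; congr (_ * _).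
have mft : measurable_fun setT (fun x : 'rV[R]_n.+1 => f (t *: x)%R).
  exact: measurableT_comp (measurable_rV_scalel t).
rewrite (ge0_integral_rVS mft (fun x => f0 _)).
apply: eq_integral => a _; apply: eq_integral => x _; congr f.
have key i : rV_cons (t * a, t *: x)%R ord0 i = (t * rV_cons (a, x) ord0 i)%R.
  case: (unliftP ord0 i) => [j ->|->]; last by rewrite !rV_cons0.
  by rewrite !rV_consS/= mxE.
by apply/rowP => i; rewrite [RHS]mxE; exact: key.
Qed.

End scaling.

(** * Comparison of integrals through their rays *)

Section polar.
Context (R : realType) (n : nat) (n0 : (0 < n)%N).
Local Notation leb := (@lebesgue_measure R).
Local Notation mu := (rV_lebesgue R n).
Implicit Types (F G : 'rV[R]_n -> \bar R).

Lemma enorm_eq0 (x : 'rV[R]_n) : (enorm x == 0) = (x == 0).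
Proof.
apply/eqP/eqP => [|->]; last first.
  by rewrite /enorm big1 ?sqrtr0// => i _; rewrite mxE expr0n.
move=> /eqP; rewrite /enorm sqrtr_eq0 => x0; apply/rowP => i; rewrite mxE.
apply/eqP; rewrite -sqrf_eq0 eq_le sqr_ge0 andbT (le_trans _ x0)//.
by rewrite (bigD1 i)//= lerDl sumr_ge0// => j _; exact: sqr_ge0.
Qed.

Lemma measurable_rV_set0 : measurable [set (0 : 'rV[R]_n)].
Proof.
rewrite (_ : [set _] = setT `&` @enorm R n @^-1` [set 0]).
  exact: measurable_enorm.
rewrite setTI; apply/seteqP; split=> x /= /eqP; rewrite ?enorm_eq0;
  last by move/eqP.
by rewrite -enorm_eq0 => /eqP.
Qed.

Let S : set (measurableTypeR R * 'rV[R]_n) :=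
  [set z | [/\ 0 < z.1, enorm z.2 <= z.1 & z.1 <= 2 * enorm z.2]].
(* For x != 0 this is a probability density in t; K t (t x) = K 1 x / t. *)
Let K (t : R) (x : 'rV[R]_n) : R := \1_S (t, x) * enorm x `^ (-1).

Let menorm2 : measurable_fun setT
  (fun z : measurableTypeR R * 'rV[R]_n => enorm z.2).
Proof. by apply: measurableT_comp;
  [exact: measurable_enorm|exact: measurable_snd]. Qed.

Let mS : measurable S.
Proof.
have -> : S = [set z | 0 < z.1] `&`
  ([set z | enorm z.2 <= z.1] `&` [set z | z.1 <= 2 * enorm z.2]).
  by apply/seteqP; split=> [z [? ? ?]|z [? [? ?]]].
have m1 : measurable_fun setT (fun z : measurableTypeR R * 'rV[R]_n => z.1 : R)
  by exact: measurable_fst.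
have m2 : measurable_fun setT (fun z : measurableTypeR R * 'rV[R]_n => 2 *
  enorm z.2).
  by apply: measurable_funM => //; exact: measurable_cst.
have mtrue : measurable [set true] by [].
have key (f g : measurableTypeR R * 'rV[R]_n -> R) : measurable_fun setT f ->
  measurable_fun setT g ->
    measurable [set z | f z <= g z].
  move=> mf mg; have := measurable_fun_ler mf mg measurableT mtrue.
  by rewrite setTI; congr (measurable _); apply/seteqP; split => z /=.
have key' (f g : measurableTypeR R * 'rV[R]_n -> R) : measurable_fun setT f ->
  measurable_fun setT g ->
    measurable [set z | f z < g z].
  move=> mf mg; have := measurable_fun_ltr mf mg measurableT mtrue.
  by rewrite setTI; congr (measurable _); apply/seteqP; split => z /=.
apply: measurableI; first by apply: key' => //; exact: measurable_cst.
by apply: measurableI; apply: key.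
Qed.

Let K_ge0 t x : 0 <= K t x.
Proof. by rewrite mulr_ge0// powR_ge0. Qed.

Let mK : measurable_fun setT (fun z : measurableTypeR R *
  'rV[R]_n => K z.1 z.2).
Proof.
apply: measurable_funM.
  rewrite (_ : (fun _ => _) = \1_S); last by apply/funext => -[].
  exact: measurable_indic.
exact: (@measurableT_comp _ _ _ _ _ _ _ _ _ (@measurable_powR R (-1)) menorm2).
Qed.

Let K_scale t x : 0 < t -> K t (t *: x) = t^-1 * K 1 x.
Proof.
move=> t0; rewrite /K enormZ (gtr0_norm t0) powRM ?enorm_ge0 ?ltW//.
rewrite powR_inv1 ?(ltW t0)// mulrCA; congr (_ * (_ * _)).
rewrite /indic; congr (_%:R); congr nat_of_bool; apply/idP/idP;
  rewrite !inE /S/= enormZ (gtr0_norm t0).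
  by move=> [_ h1 h2]; split=> //; nra.
by move=> [_ h1 h2]; split=> //; nra.
Qed.

Let int_K x : x != 0 -> (\int[leb]_t (K t x)%:E = 1)%E.
Proof.
move=> x0; have e0 : 0 < enorm x by rewrite lt_neqAle enorm_ge0 eq_sym enorm_eq0
  x0.
have -> : (fun t => (K t x)%:E) =
  (fun t => (enorm x `^ (-1))%:E * (\1_`[enorm x, 2 * enorm x]%classic t)%:E)%E.
  apply/funext => t; rewrite /K -EFinM mulrC; congr ((_ * _)%:E).
  rewrite /indic; congr (_%:R); congr nat_of_bool; apply/idP/idP;
    rewrite !inE /S/= in_itv/=.
    by move=> [_ -> ->].
  by move=> /andP[h1 h2]; split=> //; lra.
rewrite ge0_integralZl//=; last 2 first.
- by apply/measurable_EFinP; exact: measurable_indic.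
- by rewrite lee_fin powR_ge0.
rewrite integral_indic//= setIT lebesgue_measure_itv/= lte_fin.
rewrite ltr_pMl// ltr1n -EFinB -EFinM powR_inv1 ?enorm_ge0//; congr EFin.
by field; rewrite gt_eqF.
Qed.

(** The ray integral through x, with x of any length. The indicator stands in for the domain ]0,
    +oo[ so that the integrand lives on the whole product, as Tonelli's theorem requires. *)
Let A F x : \bar R := (\int[leb]_t
  ((\1_`]0%R, +oo[%classic t * t ^+ n.-1)%:E * F (t *: x)%R))%E.

Local Open Scope ereal_scope.

Let mline d (T : measurableType d) (g : T -> R) (h : T -> 'rV[R]_n) F :
  measurable_fun setT F -> measurable_fun setT g -> measurable_fun setT h ->
  measurable_fun setT (fun z => (\1_`]0%R,
    +oo[%classic (g z) * g z ^+ n.-1)%:E * F (g z *: h z)%R).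
Proof.
move=> mF mg mh; apply: emeasurable_funM; last first.
  by apply: measurableT_comp => //; exact: measurable_rV_scale.
apply/measurable_EFinP; apply: measurable_funM; last exact: measurable_funX.
by apply: measurableT_comp => //; exact: measurable_indic.
Qed.

Let line_ge0 (t : R) (y : \bar R) : 0 <= y -> 0 <=
  (\1_`]0%R, +oo[%classic t * t ^+ n.-1)%:E * y.
Proof.
move=> y0; apply: mule_ge0 => //; rewrite lee_fin indicE.
case: (boolP (t \in _)); rewrite ?mul0r// inE/= in_itv/= andbT => t0.
by rewrite mul1r exprn_ge0// ltW.
Qed.

Let mray F (x : 'rV[R]_n) : measurable_fun setT F ->
  measurable_fun setT (fun t : measurableTypeR R => (\1_`]0%R,
    +oo[%classic t * t ^+ n.-1)%:E * F (t *: x)%R).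
Proof. by move=> mF; apply: (@mline _ _ id (fun=> x)) => //;
  exact: measurable_cst. Qed.

(** The condition at the origin is there because [K t 0] is 0 for every t, so inserting the integral
    of [K] is correct only for x != 0. *)
Let integral_polar F : measurable_fun setT F -> (forall x, 0 <= F x) -> F 0%R =
  0 ->
  \int[mu]_x F x = \int[mu]_x ((K 1 x)%:E * A F x).
Proof.
move=> mF F0 F00.
pose k (z : measurableTypeR R * 'rV[R]_n) := F z.2 * (K z.1 z.2)%:E.
have mk : measurable_fun setT k.
  apply: emeasurable_funM; last exact/measurable_EFinP.
  by apply: measurableT_comp => //; exact: measurable_snd.
have k0 z : 0 <= k z by rewrite mule_ge0// lee_fin.
transitivity (\int[mu]_x \int[leb]_t k (t, x)).
  apply: eq_integral => x _; rewrite /k/=; have [->|x0] := eqVneq x 0%R.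
    by rewrite F00; under eq_integral do rewrite mul0e; rewrite integral0.
  rewrite ge0_integralZl// ?int_K ?mule1//.
    apply/measurable_EFinP.
    exact: (measurableT_comp mK (measurable_pair2 x)).
  by move=> t _; rewrite lee_fin.
rewrite -fubini_tonelli//.
pose l (z : measurableTypeR R * 'rV[R]_n) :=
  (K 1 z.2)%:E * ((\1_`]0%R, +oo[%classic z.1 * z.1 ^+ n.-1)%:E *
    F (z.1 *: z.2)%R).
have ml : measurable_fun setT l.
  apply: emeasurable_funM.
    apply/measurable_EFinP; rewrite
      (_ : (fun z => _) = (fun z => K z.1 z.2) \o
      (fun z : measurableTypeR R * 'rV[R]_n =>
      (1%R : measurableTypeR R, z.2)))//.
    apply: measurableT_comp => //; apply/measurable_fun_pairP; split;
      first exact: measurable_cst.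
    exact: measurable_snd.
  by apply: mline.
have l0 z : 0 <= l z by rewrite mule_ge0// ?lee_fin//; exact: line_ge0.
transitivity (\int[leb]_t \int[mu]_x l (t, x)); last first.
  rewrite fubini_tonelli//; apply: eq_integral => x _.
  rewrite /l/= ge0_integralZl//.
  - exact: mray.
  - by move=> t _; exact: line_ge0.
  - by rewrite lee_fin.
(* For t <= 0 both integrands vanish. For t > 0 the substitution x -> t x has Jacobian t^n, and the
   factor 1/t from [K_scale] reduces it to the polar weight t^(n-1). *)
apply: eq_integral => t _; have [t0|t0] := ltP 0%R t; last first.
  apply: eq_integral => x _; rewrite /k /l /K /= [\1_`]0%R,
    +oo[%classic _]indicE.
  rewrite memNset/=; last by rewrite in_itv/= andbT; apply/negP; rewrite -leNgt.
  rewrite indicE memNset/=; last by rewrite /S/= => -[]; rewrite ltNge t0.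
  by rewrite !mul0r mul0e !mule0.
have mkt : measurable_fun setT (fun x => k (t, x)).
  exact: (measurableT_comp mk (measurable_pair1 t)).
rewrite (ge0_integral_rV_scale (f := fun x => k (t, x)) t0)//.
have mkt' : measurable_fun setT (fun x : 'rV[R]_n => k (t, t *: x)%R).
  exact: (measurableT_comp mkt (measurable_rV_scalel t)).
have tn0 : (0 <= t ^+ n)%R by rewrite exprn_ge0// ltW.
rewrite -(ge0_integralZl_EFin mu measurableT
  (fun (x : 'rV[R]_n) _ => k0 (t, t *: x)%R) mkt' tn0).
apply: eq_integral => x _; rewrite /k /l /= (K_scale _ t0).
rewrite indicE mem_set/=; last by rewrite in_itv/= t0.
rewrite mul1r [F _ * _]muleC !muleA -!EFinM; congr (_%:E * _).
rewrite mulrA mulrC; congr (_ * _)%R.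
by rewrite -{1}(prednK n0) exprSr mulfK// gt_eqF.
Qed.

(** Substitution t -> s t. It moves any nonzero x to the unit sphere at the price of a factor common
    to both sides of the comparison. *)
Let A_scale F (s : R) x : (0 < s)%R -> measurable_fun setT F ->
  (forall x, 0 <= F x) ->
  A F x = (s ^+ n)%:E * A F (s *: x)%R.
Proof.
move=> s0 mF F0; rewrite /A (ge0_integral_lebesgue_scale s0); last 2 first.
- exact: mray.
- by move=> t; exact: line_ge0.
have -> : (s ^+ n)%:E = s%:E * (s ^+ n.-1)%:E by rewrite -EFinM -exprS prednK.
rewrite -muleA; congr (_ * _).
have sn0 : (0 <= s ^+ n.-1)%R by rewrite exprn_ge0// ltW.
rewrite -(ge0_integralZl_EFin leb measurableT _ (mray (s *: x)%R mF) sn0);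
  last first.
  by move=> t _; exact: line_ge0.
apply: eq_integral => t _; rewrite scalerA (mulrC t) muleA -EFinM;
  congr (_%:E * _).
rewrite exprMn mulrCA; congr (_ * (_ * _))%R.
rewrite !indicE; congr (_%:R)%R; congr nat_of_bool.
by apply/idP/idP; rewrite !inE/= !in_itv/= !andbT pmulr_rgt0.
Qed.

Lemma ge0_le_integral_polar F G :
  measurable_fun setT F -> (forall x, 0 <= F x) ->
  measurable_fun setT G -> (forall x, 0 <= G x) ->
  (forall w : 'rV[R]_n, enorm w = 1%R ->
    \int[leb]_(t in `]0%R, +oo[) ((t ^+ n.-1)%:E * F (t *: w)%R) <=
    \int[leb]_(t in `]0%R, +oo[) ((t ^+ n.-1)%:E * G (t *: w)%R)) ->
  F 0%R = 0 -> \int[mu]_x F x <= \int[mu]_x G x.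
Proof.
move=> mF F0 mG G0 FG F00.
(* [integral_polar] needs a function vanishing at 0. Dropping the value of [G] there can only lower
   the right-hand side, and rays with t > 0 never meet the origin. *)
pose G' x := (\1_(~` [set 0%R]) x)%:E * G x.
have G'0 x : 0 <= G' x by rewrite mule_ge0// lee_fin.
have G'00 : G' 0%R = 0 by rewrite /G' indicE memNset ?mul0e//= => /(_ erefl).
have mG' : measurable_fun setT G'.
  apply: emeasurable_funM => //; apply/measurable_EFinP.
  by apply: measurable_indic; apply: measurableC; exact: measurable_rV_set0.
apply: (@le_trans _ _ (\int[mu]_x G' x)); last first.
  apply: ge0_le_integral => // x _; rewrite /G' indicE.
  by case: (_ \in _); rewrite ?mul1e ?mul0e.
rewrite (integral_polar mF F0 F00) (integral_polar mG' G'0 G'00).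
have mA H : measurable_fun setT H -> (forall x, 0 <= H x) ->
  measurable_fun setT (A H).
  move=> mH H0.
  have mf : measurable_fun setT (fun z : measurableTypeR R * 'rV[R]_n =>
      (\1_`]0%R, +oo[%classic z.1 * z.1 ^+ n.-1)%:E * H (z.1 *: z.2)%R)
        by apply: mline.
  by apply: (@measurable_fun_fubini_tonelli_G _ _ _ _ _ leb _ mf) => z;
    exact: line_ge0.
have A0 H x : (forall x, 0 <= H x) -> 0 <= A H x.
  by move=> H0; apply: integral_ge0 => t _; exact: line_ge0.
have mK1 : measurable_fun setT (fun x => (K 1 x)%:E).
  apply/measurable_EFinP.
  exact: (measurableT_comp mK (measurable_pair1 (1%R : measurableTypeR R))).
apply: ge0_le_integral => //.
- by move=> x _; rewrite mule_ge0 ?lee_fin// A0.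
- by apply: emeasurable_funM => //; exact: mA.
- by apply: emeasurable_funM => //; exact: mA.
move=> x _; have [->|x0] := eqVneq x 0%R.
  have -> : K 1 0%R = 0%R.
    rewrite /K indicE memNset/= ?mul0r// /S/= (_ : enorm _ = 0%R);
      last by apply/eqP; rewrite enorm_eq0.
    by rewrite mulr0 => -[_ _]; rewrite ler10.
  by rewrite !mul0e.
rewrite lee_wpmul2l ?lee_fin//.
have e0 : (0 < enorm x)%R by rewrite lt_neqAle enorm_ge0 eq_sym enorm_eq0 x0.
pose w := ((enorm x)^-1 *: x)%R.
have ew : enorm w = 1%R.
  by rewrite enormZ ger0_norm ?invr_ge0 ?enorm_ge0// mulVf// gt_eqF.
have xw : x = (enorm x *: w)%R by rewrite scalerA mulfV ?scale1r// gt_eqF.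
have : A F w <= A G' w.
  have AE H : A H w = \int[leb]_(t in `]0%R, +oo[)
    ((t ^+ n.-1)%:E * H (t *: w)%R).
    rewrite [RHS]integral_mkcond; apply: eq_integral => t _;
      rewrite patchE indicE.
    by case: (t \in _); rewrite ?mul1r// mul0r mul0e.
  rewrite !AE (le_trans (FG _ ew))// le_eqVlt; apply/orP; left; apply/eqP.
  apply: eq_integral => t; rewrite inE/= in_itv/= andbT => t0; congr (_ * _).
  rewrite /G' indicE mem_set ?mul1e//= => /eqP; rewrite scaler_eq0 gt_eqF//=.
  by rewrite -enorm_eq0 ew oner_eq0.
rewrite (@A_scale F _ w e0)// (@A_scale G' _ w e0)// -xw.
by rewrite lee_pmul2l// lte_fin exprn_gt0.
Qed.

End polar.

(** * Integration against a measure given by a density, and against dV_g *)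

Section density.
Context d (T : measurableType d) (R : realType).
Variables (mu nu : {measure set T -> \bar R}) (w : T -> R).
Hypotheses (mw : measurable_fun setT w) (w0 : forall x, 0 <= w x).
Hypothesis nuE : forall A, measurable A -> nu A =
  (\int[mu]_(x in A) (w x)%:E)%E.
Local Open Scope ereal_scope.
Import HBNNSimple.

Let integral_density_nnsfun (h : {nnsfun T >-> R}) :
  \int[nu]_x (h x)%:E = \int[mu]_x ((h x)%:E * (w x)%:E).
Proof.
under [LHS]eq_integral do rewrite fimfunE -fsumEFin//.
rewrite [LHS]ge0_integral_fsum//; last 2 first.
  - by move=> r; exact/measurable_EFinP/measurableT_comp.
  - by move=> n x _; rewrite EFinM nnfun_muleindic_ge0.
under [RHS]eq_integral.
  move=> x xD; rewrite fimfunE -fsumEFin// muleC ge0_mule_fsumr; last first.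
    by move=> r; rewrite EFinM nnfun_muleindic_ge0.
  over.
rewrite [RHS]ge0_integral_fsum//; last 2 first.
  - move=> r; apply: emeasurable_funM; apply/measurable_EFinP => //.
    by apply: measurableT_comp.
  - move=> n x _; apply: mule_ge0; first by rewrite lee_fin.
    by rewrite EFinM nnfun_muleindic_ge0.
apply: eq_fsbigr => r /[!inE] -[x0 _ rE].
have r0 : 0 <= r%:E by rewrite lee_fin -rE.
have mr : measurable (h @^-1` [set r]) by [].
under [RHS]eq_integral do rewrite EFinM muleCA.
rewrite [RHS]ge0_integralZl//; last 2 first.
  - apply: emeasurable_funM; apply/measurable_EFinP => //.
  - by move=> x _; rewrite mule_ge0// ?lee_fin// lee_fin.
rewrite integralZl_indic_nnsfun// integral_indic// setIT nuE//; congr (_ * _).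
rewrite integral_mkcond; apply: eq_integral => x _.
by rewrite patchE indicE; case: (x \in _); rewrite ?mule1 ?mule0.
Qed.

(** Simple functions reduce to the values of [nu] on sets, which is how [hvol] is given; monotone
    convergence along simple approximations does the rest. *)
Lemma ge0_integral_density f : measurable_fun setT f -> (forall x, 0 <= f x) ->
  \int[nu]_x f x = \int[mu]_x (f x * (w x)%:E).
Proof.
move=> mf f0; pose f_ := nnsfun_approx measurableT mf.
transitivity (limn (fun n => \int[nu]_x (f_ n x)%:E)).
  rewrite -monotone_convergence//=.
  - apply: eq_integral => x _; apply/esym/cvg_lim => //=.
    by apply: cvg_nnsfun_approx => //.
  - by move=> n; apply/measurable_EFinP.
  - by move=> n x _; rewrite lee_fin.
  - by move=> x _ a b ab; rewrite lee_fin//; exact/lefP/nd_nnsfun_approx.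
rewrite (_ : \int[mu]_x _ = limn
  (fun n => \int[mu]_x ((f_ n x)%:E * (w x)%:E))).
  by congr (limn _); apply/funext => n /=; rewrite integral_density_nnsfun.
rewrite -monotone_convergence//=.
- apply: eq_integral => x _; apply/esym/cvg_lim => //.
  by apply: cvgeZr => //; apply: cvg_nnsfun_approx.
- by move=> n; apply: emeasurable_funM; apply/measurable_EFinP => //.
- by move=> n x _; rewrite mule_ge0// ?lee_fin// lee_fin.
- move=> x _ a b ab; rewrite lee_wpmul2r// ?lee_fin//;
  exact/lefP/nd_nnsfun_approx.
Qed.

End density.

Section hvol_integral.
Context (R : realType) (n : nat).
Local Open Scope ereal_scope.

Lemma ge0_integral_hvol (D : set 'rV[R]_n) (f : 'rV[R]_n -> \bar R) :
  measurable D -> D `<=` @hball R n -> measurable_fun D f ->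
    (forall x, D x -> 0 <= f x) ->
  \int[@hvol R n]_(x in D) f x =
    \int[rV_lebesgue R n]_(x in D) (f x * (conf x ^+ n)%:E).
Proof.
move=> mD DB mf f0.
rewrite [LHS]integral_mkcond [RHS]integral_mkcond.
(* The extension by zero keeps the density nonnegative: [conf] is negative beyond the unit sphere,
   so for odd n its power would be too. *)
pose w := (fun x : 'rV[R]_n => (conf x ^+ n)%R) \_ (@hball R n).
have mB := @measurable_hball R n.
rewrite (@ge0_integral_density _ _ _ (rV_lebesgue R n) _ w).
- apply: eq_integral => x _; rewrite /w !patchE.
  case: (boolP (x \in D)) => xD; rewrite ?mul0e//.
  by rewrite (mem_set (DB x _))//; rewrite inE in xD.
- apply/(measurable_restrictT (fun x : 'rV[R]_n => (conf x ^+ n)%R) mB).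
  by apply: measurable_realfun.measurable_funX; exact: measurable_conf.
- move=> x; rewrite /w patchE; case: ifPn => // /[!inE] xB.
  by rewrite exprn_ge0// conf_ge0.
- move=> A mA; rewrite /= /hvol integral_mkcondr; apply: eq_integral => x _.
  by rewrite /w !patchE; case: ifP.
- exact/(measurable_restrictT f mD).
- by move=> x; apply: erestrict_ge0.
Qed.

End hvol_integral.

(** * Young's inequality and the derivative of |y|^p *)

Section one_dim.
Context (R : realType).
Local Notation leb := (@lebesgue_measure R).

(** Young's inequality for a and b^(p-1) with exponents p and p/(p-1), multiplied by p. *)
Lemma young_powR (p a b : R) : 1 < p -> 0 <= a -> 0 <= b ->
  p * (a * b `^ (p - 1)) <= a `^ p + (p - 1) * b `^ p.
Proof.
move=> p1 a0 b0; have p0 : 0 < p by lra.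
have := @conjugate_powR _ a (b `^ (p - 1)) p (p / (p - 1)) a0 (powR_ge0 _ _) p0.
have -> : 0 < p / (p - 1) by rewrite divr_gt0//; lra.
move=> /(_ isT) H; have E1 : p^-1 + (p / (p - 1))^-1 = 1.
  by field; apply/andP; split; lra.
move/(_ E1): H; rewrite -powRrM (_ : (p - 1) * (p / (p - 1)) = p);
  last by field; lra.
move=> H; rewrite -ler_pdivlMl//; apply: le_trans H _.
rewrite le_eqVlt; apply/orP; left; apply/eqP; field.
by apply/andP; split; lra.
Qed.

(** Away from 0 this is the power rule. At 0 the difference quotient has absolute value |h|^(p-1),
    which tends to 0 because p > 1. *)
Lemma is_derive_norm_powR (p y : R) : 1 < p ->
  is_derive y 1 (fun z => `|z| `^ p) (p * (Num.sg y * `|y| `^ (p - 1))).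
Proof.
move=> p1; have [y0|y0|->] := ltgtP y 0.
- have H : is_derive y 1 ((@powR R ^~ p) \o (@GRing.opp R))
  (p * `|y| `^ (p - 1) * -1).
    apply: is_derive1_comp.
    rewrite ltr0_norm//; apply: is_derive1_powR; lra.
  rewrite (ltr0_sg y0) mulN1r mulrN -mulrN1.
  apply: near_eq_is_derive H.
  near=> z; rewrite /= ltr0_norm//; near: z; exact: lt_nbhsl.
- have H : is_derive y 1 (@powR R ^~ p) (p * `|y| `^ (p - 1)).
    by rewrite gtr0_norm//; apply: is_derive1_powR.
  rewrite (gtr0_sg y0) mul1r.
  apply: near_eq_is_derive H.
  near=> z; rewrite /= gtr0_norm//; near: z; exact: lt_nbhsr.
- rewrite sgr0 mul0r mulr0.
  have H : h^-1 *: (((fun z : R => `|z| `^ p) \o shift 0) (h *: 1) - `|0 :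
    R| `^ p) @[h --> (0:R)^'] --> (0:R).
    apply/cvgrPdist_lt => e e0; near=> h.
    have h0 : h != 0 by near: h; exact: nbhs_dnbhs_neq.
    rewrite sub0r normrN /= normr0 powR0 ?subr0; last lra.
    rewrite /shift/= addr0 -[h *: 1]/(h * 1) mulr1 normrM normfV
      (ger0_norm (powR_ge0 _ _)).
    have hp : 0 < `|h| by rewrite normr_gt0.
    have -> : `|h|^-1 * `|h| `^ p = `|h| `^ (p - 1).
      by rewrite powRB ?powRr1 1?mulrC// (gt_eqF hp) implybT.
    have -> : e = (e `^ (p - 1)^-1) `^ (p - 1).
      by rewrite -powRrM mulVf ?powRr1 ?ltW//; lra.
    apply: gt0_ltr_powR; rewrite ?nnegrE ?powR_ge0//; first lra.
    by near: h; apply: dnbhs0_lt; rewrite powR_gt0.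
  by split; [apply/cvg_ex; exists 0; exact: H|exact/cvg_lim].
Unshelve. all: end_near. Qed.

(** Makes the derivative of |u|^p t continuous, so that the fundamental theorem of calculus applies
    to it. *)
Lemma continuous_norm_powR_deriv (p : R) : 1 < p ->
  continuous (fun y : R => Num.sg y * `|y| `^ (p - 1)).
Proof.
move=> p1 y.
have key (f : R -> R) : {for y, continuous f} ->
    (\forall z \near y, f z = Num.sg z * `|z| `^ (p - 1)) ->
    {for y, continuous (fun y : R => Num.sg y * `|y| `^ (p - 1))}.
  move=> cf H; rewrite /prop_for /continuous_at -(nbhs_singleton H).
  by apply: cvg_trans cf; apply: near_eq_cvg; apply: filterS H => z.
have cpow (z : R) : 0 < z -> {for z, continuous (@powR R ^~ (p - 1))}.
  move=> z0; apply: differentiable_continuous; apply/derivable1_diffP.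
  by have [] := is_derive1_powR (p - 1) z0.
have [y0|y0|->] := ltgtP y 0.
- apply: (key (fun z => - ((- z) `^ (p - 1)))).
    apply: continuousN; apply: (@continuous_comp _ _ _ (@GRing.opp R)
      (@powR R ^~ (p - 1))); first exact: opp_continuous.
    by apply: cpow; rewrite oppr_gt0.
  near=> z; have z0 : z < 0 by near: z; exact: lt_nbhsl.
  by rewrite ltr0_norm// ltr0_sg// mulN1r.
- apply: (key _ (cpow _ y0)).
  near=> z; have z0 : 0 < z by near: z; exact: lt_nbhsr.
  by rewrite gtr0_norm// gtr0_sg// mul1r.
- apply/cvgrPdist_lt => e e0; near=> z.
  rewrite sgr0 mul0r sub0r normrN normrM (ger0_norm (powR_ge0 _ _)) normr_sg.
  apply: (@le_lt_trans _ _ (`|z| `^ (p - 1))).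
    by rewrite ler_piMl ?powR_ge0// lern1 leq_b1.
  have -> : e = (e `^ (p - 1)^-1) `^ (p - 1).
    by rewrite -powRrM mulVf ?powRr1 ?ltW//; lra.
  apply: gt0_ltr_powR; rewrite ?nnegrE ?powR_ge0//; first lra.
  near: z; apply/nbhs_ballP; exists (e `^ (p - 1)^-1);
    rewrite /= ?powR_gt0// => x.
  by rewrite /ball/= sub0r normrN.
Unshelve. all: end_near. Qed.

(** * The weighted Hardy inequality on an interval *)

Section hardy.
Variables (p b b0 : R) (u du w h t dt e : R -> R).
Hypotheses (p1 : 1 < p) (b_ge0 : 0 <= b) (bb0 : b < b0).
Hypothesis u_der : forall r : R, is_derive r 1 u (du r).
Hypothesis du_cont : continuous du.
Hypothesis u_supp : forall r, b < r -> u r = 0.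
Hypothesis t_der : forall r : R, 0 < r < b0 -> is_derive r 1 t (dt r).
Hypothesis dt_cont : forall r : R, 0 < r < b0 -> {for r, continuous dt}.
Hypothesis w0 : forall r, 0 < r < b0 -> 0 <= w r.
Hypothesis h0 : forall r, 0 < r < b0 -> 0 <= h r.
Hypothesis e0 : forall r, 0 < r < b0 -> 0 <= e r.
(** With this shape, differentiating |u|^p in |u|^p t yields exactly the cross term of Young's
    inequality for a = |u'|, b = h |u|, multiplied by w. By [dtE], the term |u|^p t' then pays for
    the loss (p-1) h^p w |u|^p and leaves (h^p w + e) |u|^p. *)
Hypothesis tE : forall r, 0 < r < b0 -> t r = h r `^ (p - 1) * w r.
Hypothesis dtE : forall r, 0 < r < b0 -> p * (h r `^ p * w r) + e r <= dt r.
Let A r := (h r `^ p * w r + e r) * `|u r| `^ p.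
Let D r := w r * `|du r| `^ p.
Hypothesis mA : measurable_fun `]0, b0[ A.
Hypothesis mD : measurable_fun `]0, b0[ D.

(* The inequality is the integral of A <= D + G' over [c, b1], where
   G b1 = 0 <= G c. *)
Let G r := `|u r| `^ p * t r.
Let dG r := `|u r| `^ p * dt r + t r *
  (p * (Num.sg (u r) * `|u r| `^ (p - 1)) * du r).

Let G_der (r : R) : 0 < r < b0 -> is_derive r 1 G (dG r).
Proof.
move=> rb; have H1 := is_derive1_comp (is_derive_norm_powR (u r) p1) (u_der r).
have H2 := t_der rb.
exact: (is_deriveM H1 H2).
Qed.

Let dG_cont (r : R) : 0 < r < b0 -> {for r, continuous dG}.
Proof.
move=> rb.
have cu : {for r, continuous u}.
  by apply: differentiable_continuous; apply/derivable1_diffP;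
    have [] := u_der r.
have ct : {for r, continuous t}.
  by apply: differentiable_continuous; apply/derivable1_diffP;
    have [] := t_der rb.
have cup : {for r, continuous (fun r => `|u r| `^ p)}.
  have H := is_derive1_comp (is_derive_norm_powR (u r) p1) (u_der r).
  by apply: differentiable_continuous; apply/derivable1_diffP; case: H.
apply: continuousD; first by apply: continuousM => //; exact: dt_cont.
apply: continuousM => //; apply: continuousM; last exact: du_cont.
apply: continuousM; first exact: cst_continuous.
exact: (@continuous_comp _ _ _ u (fun y => Num.sg y * `|y| `^ (p - 1)) r cu
  (@continuous_norm_powR_deriv p p1 _)).
Qed.

Let pointwise r : 0 < r < b0 -> A r <= D r + dG r.
Proof.
move=> rb; have Y := young_powR p1 (normr_ge0 (du r))
  (mulr_ge0 (h0 rb) (normr_ge0 (u r))).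
have wr := w0 rb; have hr := h0 rb.
rewrite /A /D /dG (tE rb).
rewrite !powRM// in Y.
set U := `|u r| `^ p in Y *; set V := `|u r| `^ (p - 1) in Y *.
set H := h r `^ p in Y *; set H' := h r `^ (p - 1) in Y *.
have U0 : 0 <= U by exact: powR_ge0.
have V0 : 0 <= V by exact: powR_ge0.
have H'0 : 0 <= H' by exact: powR_ge0.
have h1 : U * (p * (H * w r) + e r) <= U * dt r by rewrite ler_wpM2l// dtE.
have h2 : - (w r * (`|du r| `^ p + (p - 1) * (H * U))) <=
    H' * w r * (p * (Num.sg (u r) * V) * du r).
  apply: (@le_trans _ _ (- (w r * (p * (`|du r| * (H' * V)))))).
    by rewrite lerN2 ler_wpM2l.
  (* The derivative of |u| may have either sign; only its lower bound -|u'| matters, since every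
     other factor of the cross term is nonnegative. *)
  have h3 : - `|du r| <= Num.sg (u r) * du r.
    rewrite lerNl (le_trans (ler_norm _))// normrN normrM normr_sg.
    by rewrite ler_piMl// lern1 leq_b1.
  have -> : H' * w r * (p * (Num.sg (u r) * V) * du r) =
    p * H' * V * w r * (Num.sg (u r) * du r) by ring.
  have -> : - (w r * (p * (`|du r| * (H' * V)))) = p * H' * V * w r * -
    `|du r| by ring.
  have p0 : 0 <= p by rewrite ltW// (lt_trans ltr01).
  by apply: ler_wpM2l => //; rewrite !mulr_ge0.
lra.
Qed.

Local Open Scope ereal_scope.

(** An endpoint beyond the support of u, where [G] vanishes, yet strictly below b0, where [t] and
    [dt] are still regular. *)
Let b1 := ((b + b0) / 2)%R.

Let compact_ineq c : (0 < c < b1)%R ->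
  \int[leb]_(r in `[c, b1]) (A r)%:E <= \int[leb]_(r in `]0%R, b0[) (D r)%:E.
Proof.
move=> /andP[c0 cb1]; have [[p_gt1 lt_bb0] b0'] := (p1, bb0, b_ge0).
have bb1 : (b < b1)%R by rewrite /b1; lra.
have b10 : (b1 < b0)%R by rewrite /b1; lra.
have sub : `[c, b1] `<=` `]0%R, b0[.
  by move=> r /=; rewrite !in_itv/= => /andP[? ?]; apply/andP; split; lra.
have sub' r : (r \in `[c, b1]) -> (0 < r < b0)%R.
  by move=> /sub /=; rewrite in_itv.
have A0 r : (0 < r < b0)%R -> (0 <= A r)%R.
  by move=> rb; rewrite mulr_ge0 ?powR_ge0// addr_ge0 ?e0// mulr_ge0 ?powR_ge0
    ?w0.
have D0 r : (0 < r < b0)%R -> (0 <= D r)%R.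
  by move=> rb; rewrite mulr_ge0 ?powR_ge0// w0.
have cdG : {within `[c, b1], continuous dG}.
  by apply: continuous_in_subspaceT => r; rewrite inE/= => /sub';
    exact: dG_cont.
have mdG : measurable_fun `[c, b1] dG.
  by apply: subspace_continuous_measurable_fun.
have mA' : measurable_fun `[c, b1] A by apply: measurable_funS mA.
have mD' : measurable_fun `[c, b1] D by apply: measurable_funS mD.
have cG r : (0 < r < b0)%R -> {for r, continuous G}.
  move=> rb; apply: differentiable_continuous; apply/derivable1_diffP.
  by have [] := G_der rb.
apply: (@le_trans _ _ (\int[leb]_(r in `[c, b1]) (D r)%:E)); last first.
  by apply: ge0_subset_integral => //; exact/measurable_EFinP.
(* The integral of [D + dG] can be split only if both are integrable, as [dG] has no sign. [D] is
   merely measurable, so its finiteness is a case distinction; the infinite case is trivial. *)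
have [->|Dfin] := eqVneq (\int[leb]_(r in `[c, b1]) (D r)%:E) +oo;
  first by rewrite leey.
have iD : leb.-integrable `[c, b1] (EFin \o D).
  apply/integrableP; split; first exact/measurable_EFinP.
  rewrite (_ : \int[_]_(x in _) _ = \int[leb]_(r in `[c, b1]) (D r)%:E) ?ltey//.
  by apply: eq_integral => r; rewrite inE => /sub' rb;
    rewrite /= ger0_norm// D0.
have idG : leb.-integrable `[c, b1] (EFin \o dG).
  by apply: continuous_compact_integrable => //; exact: segment_compact.
have FTC : \int[leb]_(r in `[c, b1]) (dG r)%:E = (G b1)%:E - (G c)%:E.
  apply: continuous_FTC2 => //; last first.
    move=> r; rewrite in_itv/= => /andP[r1 r2]; rewrite derive1E.
    have rb : (0 < r < b0)%R by apply/andP; split; lra.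
    by have [_ ->] := G_der rb.
  split.
  - move=> r; rewrite in_itv/= => /andP[r1 r2].
    have rb : (0 < r < b0)%R by apply/andP; split; lra.
    by have [] := G_der rb.
  - by apply: cvg_at_right_filter; apply: cG; apply/andP; split; lra.
  - by apply: cvg_at_left_filter; apply: cG; apply/andP; split; lra.
apply: (@le_trans _ _ (\int[leb]_(r in `[c, b1]) (D r + dG r)%:E)).
  apply: ge0_le_integral => //.
  - by move=> r /sub' rb; rewrite lee_fin A0.
  - exact/measurable_EFinP.
  - by apply/measurable_EFinP; exact: measurable_funD.
  - by move=> r /sub' rb; rewrite lee_fin pointwise.
under eq_integral do rewrite EFinD.
rewrite integralD//= FTC -[leRHS]adde0 leeD2l// -EFinB lee_fin.
rewrite /G u_supp// normr0 powR0; last lra.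
rewrite mul0r sub0r oppr_le0 mulr_ge0 ?powR_ge0// tE; last by apply/andP; split;
  lra.
by rewrite mulr_ge0 ?powR_ge0// w0//; apply/andP; split; lra.
Qed.

Lemma hardy_one_dim :
  \int[leb]_(r in `]0%R, b0[) (A r)%:E <= \int[leb]_(r in `]0%R, b0[) (D r)%:E.
Proof.
have [[p_gt1 lt_bb0] b0'] := (p1, bb0, b_ge0).
have b1_gt0 : (0 < b1)%R by rewrite /b1; lra.
have bb1 : (b < b1)%R by rewrite /b1; lra.
have b10 : (b1 < b0)%R by rewrite /b1; lra.
(* The divisor starts at 2 so that the left end is strictly below b1, as [compact_ineq] demands.
   These intervals exhaust ]0, b1], beyond which [A] is zero. *)
pose F (k : nat) : set R := `[(b1 / k.+2%:R)%R, b1]%classic.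
have UF : \bigcup_k F k = `]0%R, b1]%classic.
  apply/seteqP; split=> r /=.
    move=> [k _]; rewrite /F /= !in_itv/= => /andP[r1 ->]; rewrite andbT.
    by apply: lt_le_trans r1; rewrite divr_gt0.
  rewrite in_itv/= => /andP[r0 r1].
  have rb : (0 < r / b1)%R by rewrite divr_gt0.
  have [k _ /(_ k.+1 (leqnSn _)) /= kr] := near_infty_natSinv_lt (PosNum rb).
  exists k => //; rewrite /F/= in_itv/= r1 andbT ltW//.
  by rewrite -ltr_pdivlMl// mulrC.
have -> : \int[leb]_(r in `]0%R, b0[) (A r)%:E =
  \int[leb]_(r in \bigcup_k F k) (A r)%:E.
  rewrite UF [LHS]integral_mkcond [RHS]integral_mkcond;
    apply: eq_integral => r _.
  rewrite !patchE !mem_setE !in_itv/=; case: (ltP 0%R r) => //= r0.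
  case: (leP r b1) => rb1; first by rewrite (le_lt_trans rb1).
  by case: ifP => // _; rewrite /A u_supp ?(lt_trans bb1)// normr0 powR0
    ?mulr0//; lra.
have Fsub k : F k `<=` `]0%R, b0[.
  move=> r; have : (\bigcup_k F k) r -> (`]0%R, b0[%classic r).
    by rewrite UF /= !in_itv/= => /andP[-> ?] /=; lra.
  by move=> H Fr; apply: H; exists k.
have A0 r : (0 < r < b0)%R -> (0 <= A r)%R.
  by move=> rb; rewrite mulr_ge0 ?powR_ge0// addr_ge0 ?e0// mulr_ge0 ?powR_ge0
    ?w0.
have cF : \int[leb]_(r in F k) (A r)%:E @[k --> \oo] -->
  \int[leb]_(r in \bigcup_k F k) (A r)%:E.
  apply: ge0_nondecreasing_set_cvg_integral => //.
  - move=> k l kl; apply/subsetPset => r;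
    rewrite /F /= !in_itv/= => /andP[r1 ->].
    rewrite andbT (le_trans _ r1)// ler_pM2l// lef_pV2 ?posrE//.
    by rewrite ler_nat ltnS.
  - by move=> k; rewrite /F.
  - move=> k; apply/measurable_EFinP; apply: measurable_funS mA => //.
  - by move=> k r /Fsub; rewrite /= in_itv/= => rb; rewrite lee_fin A0.
rewrite -(cvg_lim _ cF)//; apply: lime_le; first by apply/cvg_ex; eexists;
  exact: cF.
apply: nearW => k; apply: compact_ineq; rewrite divr_gt0//=.
by rewrite ltr_pdivrMr// ltr_pMr// ltr1n.
Qed.

End hardy.
End one_dim.

(** * Hyperbolic functions of the radius *)

Section radial.
Context (R : realType).
Implicit Types r x : R.

(** Radial profile of [rho], as [hconf] is of [conf]: composing with [enorm] gives those functions
    back by conversion. *)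
Definition hdist r : R := ln ((1 + r) / (1 - r)).
Definition hconf r : R := 2 / (1 - r ^+ 2).

Lemma hconf_gt0 r : 0 < r < 1 -> 0 < hconf r.
Proof. by move=> ?; rewrite divr_gt0//; nra. Qed.

Lemma hdist0 : hdist 0 = 0.
Proof. by rewrite /hdist addr0 subr0 divr1 ln1. Qed.

Lemma is_derive_hdist r : 0 <= r < 1 -> is_derive r 1 hdist (hconf r).
Proof.
move=> /andP[r0 r1].
have H1 : is_derive r 1 (fun x : R => 1 + x) 1.
  by apply: is_derive_eq; ring.
have H2 : is_derive r 1 (fun x : R => 1 - x) (-1).
  by apply: is_derive_eq; ring.
have r2 : 1 - r != 0 by rewrite gt_eqF//; lra.
have H3 := @is_deriveV R (fun x : R => 1 - x) r _ _ r2 H2.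
have H4 := @is_deriveM R _ (fun x : R => 1 + x) (fun x : R => (1 - x)^-1) r 1 _
  _ H1 H3.
have q0 : 0 < (1 + r) / (1 - r) by rewrite divr_gt0//; lra.
have H5 := @is_derive1_comp R (@ln R) (fun x : R => (1 + x) / (1 - x)) r _ _
  (is_derive1_ln q0) H4.
apply: (is_derive_eq H5).
rewrite /hconf /GRing.scale/=; field.
by apply/and3P; split; nra.
Qed.

(** With l = [hdist x] this is the r-derivative of sinh l, namely conf cosh l, where cosh l = (1 +
    x^2) / (1 - x^2). *)
Lemma is_derive_mul_hconf x : 0 <= x < 1 ->
  is_derive x 1 (fun x => x * hconf x) (2 * (1 + x ^+ 2) / (1 - x ^+ 2) ^+ 2).
Proof.
move=> /andP[x0 x1].
have H2 : is_derive x 1 (fun x : R => 1 - x ^+ 2) (- (2 * x)).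
  by apply: is_derive_eq; rewrite /GRing.scale/=; ring.
have x2 : 1 - x ^+ 2 != 0 by rewrite gt_eqF//; nra.
have H3 := @is_deriveV R (fun x : R => 1 - x ^+ 2) x _ _ x2 H2.
rewrite /hconf; apply: is_derive_eq; rewrite /GRing.scale/=; field.
exact: x2.
Qed.

(** In terms of l this reads 2 tanh(l/2) <= l <= sinh l. Each difference vanishes at 0 and has a
    nonnegative derivative, so the mean value theorem gives its sign. *)
Lemma hdist_bounds r : 0 < r < 1 -> 2 * r <= hdist r <= r * hconf r.
Proof.
move=> /andP[r0 r1].
have cont (x : R) (f : R -> R) (d : R) : is_derive x 1 f d ->
  {for x, continuous f}.
  by move=> [d1 _]; apply: differentiable_continuous; apply/derivable1_diffP.
have MV (f df : R -> R) : (forall x : R, 0 <= x < 1 -> is_derive x 1 f (df x))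
  ->
    (forall x : R, 0 <= x < 1 -> 0 <= df x) -> f 0 = 0 -> 0 <= f r.
  move=> fd df0 f0.
  have [x||c] := @MVT R f df 0 r r0.
  - by rewrite in_itv/= => /andP[x0 xr]; apply: fd; apply/andP; split; lra.
  - apply: continuous_in_subspaceT => x; rewrite inE/= in_itv/= => /andP[x0 xr].
    by apply: cont (fd x _); apply/andP; split; lra.
  rewrite in_itv/= => /andP[c0 cr]; rewrite f0 !subr0 => ->.
  by rewrite mulr_ge0 ?df0 ?ltW//; apply/andP; split; lra.
apply/andP; split; rewrite -subr_ge0.
- apply: (MV (fun x => hdist x - 2 * x) (fun x => hconf x - 2)).
  + move=> x x01; have H := is_derive_hdist x01.
    by apply: is_derive_eq; rewrite /GRing.scale/= mulr1.
  + move=> x /andP[x0 x1]; rewrite /hconf subr_ge0 ler_pdivlMr; nra.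
  + by rewrite hdist0 mulr0 subr0.
- apply: (MV (fun x => x * hconf x - hdist x)
  (fun x => 2 * (1 + x ^+ 2) / (1 - x ^+ 2) ^+ 2 - hconf x)).
  + by move=> x x01; have H := is_derive_hdist x01;
    have H' := is_derive_mul_hconf x01; apply: is_derive_eq.
  + move=> x /andP[x0 x1].
    have D0 : 0 < 1 - x ^+ 2 by nra.
    have -> : 2 * (1 + x ^+ 2) / (1 - x ^+ 2) ^+ 2 - hconf x = 4 *
      x ^+ 2 / (1 - x ^+ 2) ^+ 2.
      by rewrite /hconf; field; rewrite gt_eqF.
    by rewrite divr_ge0// ?sqr_ge0// mulr_ge0// sqr_ge0.
  + by rewrite hdist0 mul0r subr0.
Qed.

Lemma hdist_gt0 r : 0 < r < 1 -> 0 < hdist r.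
Proof. by move=> r01; have := hdist_bounds r01; lra. Qed.

(* With l = hdist r, the right-hand side is coth l. *)
Lemma hcoth_ge n r : (2 <= n)%N -> 0 < r < 1 ->
  (hdist r)^-1 + hdist r * (hconf r ^+ n)^-1 <= (1 + r ^+ 2) / (2 * r).
Proof.
move=> n2 r01; have k0 := hconf_gt0 r01; have L0 := hdist_gt0 r01.
have /andP[L1 L2] := hdist_bounds r01.
move: r01 => /andP[r0 r1].
have k1 : 1 <= hconf r by rewrite /hconf ler_pdivlMr; nra.
have h1 : (hconf r ^+ n)^-1 <= (hconf r ^+ 2)^-1.
  by rewrite lef_pV2 ?posrE ?exprn_gt0//; exact: ler_weXn2l.
(* From l <= r conf one gets l conf^(-2) <= r^2 / l. The left-hand side of the lemma is then at most
   (1 + r^2) / l, and l >= 2 r finishes. *)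
have h2 : hdist r * (hconf r ^+ n)^-1 <= r ^+ 2 / hdist r.
  apply: (@le_trans _ _ (hdist r * (hconf r ^+ 2)^-1));
    first by rewrite ler_pM2l.
  rewrite ler_pdivrMr ?exprn_gt0// mulrAC ler_pdivlMr// -!expr2 -exprMn.
  rewrite ler_sqr ?nnegrE//; first exact: ltW.
  by rewrite mulr_ge0 ?ltW.
apply: (@le_trans _ _ ((1 + r ^+ 2) / hdist r)).
  by rewrite mulrDl mul1r lerD2l.
by rewrite ler_pM2l; [rewrite lef_pV2 ?posrE//; lra|nra].
Qed.

End radial.

(** * The Hardy inequality on a ray of the ball *)

Section radial_hardy.
Context (R : realType).
Local Notation leb := (@lebesgue_measure R).
Variables (n : nat) (p C b b0 : R) (wt eta q dq P Q : R -> R) (u du : R -> R).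
Hypotheses (n2 : (2 <= n)%N) (p1 : 1 < p) (C0 : 0 < C).
Hypotheses (b_ge0 : 0 <= b) (bb0 : b < b0) (b01 : b0 <= 1).
Hypothesis u_der : forall r : R, is_derive r 1 u (du r).
Hypothesis du_cont : continuous du.
Hypothesis u_supp : forall r, b < r -> u r = 0.
Hypotheses (mwt : measurable_fun setT wt) (mP : measurable_fun setT P)
  (mQ : measurable_fun setT Q).
(** The geodesic distances that occur on the ray. The weights are regular only there: l > 0 in (a),
    and 0 < l < 1 in (b), where ln(1/l) must be positive. *)
Let good (l : R) := exists2 r : R, 0 < r < b0 & l = hdist r.
Hypothesis q_der : forall l : R, good l -> is_derive l 1 q (dq l).
Hypothesis dq_cont : forall l : R, good l -> {for l, continuous dq}.
Hypothesis wt0 : forall l, 0 <= wt l.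
Hypothesis eta0 : forall l, good l -> 0 <= eta l.
Hypothesis qE : forall l, good l -> q l = eta l `^ (p - 1) * wt l.
Hypothesis PE : forall l, good l -> P l = eta l `^ p * wt l.
Hypothesis QE : forall l, good l -> Q l = l * q l.
(** Multiplied by l^(n-1), this says (l^(n-1) q)' = p C l^(n-1) P: the equation of flat space, in
    which 1/l takes the place of coth l. *)
Hypothesis qODE : forall l, good l -> (n%:R - 1) * (q l / l) + dq l = p * C *
  P l.

(* hconf is dl/dr for l = hdist r, and r * hconf r = sinh l. *)
Let w r := hconf r ^+ n / hconf r `^ p * wt (hdist r) * r ^+ n.-1.
(** The factor [hconf r] turns the slope C eta, taken with respect to geodesic distance, into a
    slope with respect to r. *)
Let h r := hconf r * C * eta (hdist r).
Let t r := C `^ (p - 1) * (r * hconf r) ^+ n.-1 * q (hdist r).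
Let dt r := C `^ (p - 1) * (r * hconf r) ^+ n.-1 * hconf r *
  ((n%:R - 1) * ((1 + r ^+ 2) / (2 * r)) * q (hdist r) + dq (hdist r)).
(** The gain from the summand l conf^(-n) in the bound for coth l. Its conf^(-n) cancels the conf^n
    present in [dt], which leaves a density for dx. *)
Let e r := (n%:R - 1) * C `^ (p - 1) * r ^+ n.-1 * Q (hdist r).

Let nE : n = n.-2.+2. Proof. by case: n n2 => [|[|]]. Qed.

Let rb1 r : 0 < r < b0 -> 0 < r < 1.
Proof. by move=> /andP[-> /lt_le_trans]; exact. Qed.

Let rb01 r : 0 < r < b0 -> 0 <= r < 1.
Proof. by move=> /rb1/andP[/ltW -> ->]. Qed.

Let goodL r : 0 < r < b0 -> good (hdist r). Proof. by exists r. Qed.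

Let t_der (r : R) : 0 < r < b0 -> is_derive r 1 t (dt r).
Proof.
move=> rb; have H1 := is_derive_mul_hconf (rb01 rb).
have H2 := @is_deriveX R _ (fun x : R => x * hconf x) n.-1 r 1 _ H1.
have H3 := @is_derive1_comp R q (@hdist R) r _ _ (q_der (goodL rb))
  (is_derive_hdist (rb01 rb)).
have H4 := @is_deriveM R _ _ _ r 1 _ _ H2 H3.
have H5 := @is_deriveZ R _ _ _ (C `^ (p - 1)) r 1 _ H4.
have -> : t = (C `^ (p - 1) \*:
  ((fun x : R => x * hconf x) ^+ n.-1 * (q \o @hdist R))).
  by apply/funext => x; rewrite /t -mulrA exprfctE.
apply: (is_derive_eq H5); rewrite /dt /GRing.scale/=.
have /andP[r0 r1] := rb1 rb.
have r2 : 1 - r ^+ 2 != 0 by rewrite gt_eqF//; nra.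
have -> : n%:R - 1 = n.-1%:R :> R by rewrite nE /= -natr1 addrK.
rewrite fctE [in n.-1](nE) /= exprS -mulr_natr /hconf.
by field; rewrite r2 gt_eqF.
Qed.

Let hconf_cont (r : R) : 0 < r < b0 -> {for r, continuous (@hconf R)}.
Proof.
move=> rb; have /andP[r0 r1] := rb1 rb.
apply: continuousM; first exact: cst_continuous.
apply: continuousV; first by rewrite gt_eqF//; nra.
apply: continuousB; first exact: cst_continuous.
exact: exprn_continuous.
Qed.

Let hdist_cont (r : R) : 0 < r < b0 -> {for r, continuous (@hdist R)}.
Proof.
move=> rb; apply: differentiable_continuous; apply/derivable1_diffP.
by have [] := is_derive_hdist (rb01 rb).
Qed.

Let q_cont (l : R) : good l -> {for l, continuous q}.
Proof.
move=> gl; apply: differentiable_continuous; apply/derivable1_diffP.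
by have [] := q_der gl.
Qed.

Let dt_cont (r : R) : 0 < r < b0 -> {for r, continuous dt}.
Proof.
move=> rb; have /andP[r0 r1] := rb1 rb.
have ch := hconf_cont rb; have cl := hdist_cont rb.
have cid : {for r, continuous (fun x : R => x)} by [].
have cX (f : R -> R) m : {for r, continuous f} ->
  {for r, continuous (fun x => f x ^+ m)}.
  by move=> cf; apply: (@continuous_comp _ _ _ f (fun x => x ^+ m)) => //;
    exact: exprn_continuous.
have cq : {for r, continuous (q \o @hdist R)}.
  by apply: continuous_comp => //; exact/q_cont/goodL.
have cdq : {for r, continuous (dq \o @hdist R)}.
  by apply: continuous_comp => //; exact/dq_cont/goodL.
apply: continuousM.
  apply: continuousM => //; apply: continuousM; first exact: cst_continuous.
  by apply: cX; apply: continuousM.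
apply: continuousD => //; apply: continuousM => //.
apply: continuousM; first exact: cst_continuous.
apply: continuousM.
  by apply: continuousD; [exact: cst_continuous|exact: cX].
apply: continuousV; first by rewrite gt_eqF// mulr_gt0.
by apply: continuousM => //; exact: cst_continuous.
Qed.

Let w0 r : 0 < r < b0 -> 0 <= w r.
Proof.
move=> rb; have k0 := hconf_gt0 (rb1 rb); have /andP[r0 _] := rb.
by rewrite !mulr_ge0// ?invr_ge0 ?powR_ge0 ?exprn_ge0// ltW.
Qed.

Let h0 r : 0 < r < b0 -> 0 <= h r.
Proof.
move=> rb; have k0 := hconf_gt0 (rb1 rb).
by rewrite mulr_ge0 ?(eta0 (goodL rb))// mulr_ge0 ?ltW.
Qed.

Let q0 l : good l -> 0 <= q l.
Proof. by move=> gl; rewrite qE// mulr_ge0 ?powR_ge0. Qed.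

Let nn1 : 0 <= n%:R - 1 :> R.
Proof. by rewrite subr_ge0 ler1n (leq_trans _ n2). Qed.

Let e0 r : 0 < r < b0 -> 0 <= e r.
Proof.
move=> rb; have /andP[r0 _] := rb; have gl := goodL rb.
rewrite /e QE//.
by rewrite !mulr_ge0 ?powR_ge0 ?exprn_ge0 ?q0// ltW// hdist_gt0 ?rb1.
Qed.

Let tE r : 0 < r < b0 -> t r = h r `^ (p - 1) * w r.
Proof.
move=> rb; have k0 := hconf_gt0 (rb1 rb); have gl := goodL rb.
have e1 := eta0 gl; have k1 := ltW k0; have C1 := ltW C0;
  have kC := mulr_ge0 k1 C1.
rewrite /t /h /w qE// (powRM _ kC e1) (powRM _ k1 C1).
have -> : hconf r `^ (p - 1) = hconf r `^ p / hconf r.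
  by rewrite powRB ?powRr1// (gt_eqF k0) implybT.
rewrite exprMn nE /= [hconf r ^+ n.-2.+2]exprS.
by field; rewrite !gt_eqF ?powR_gt0.
Qed.

Let hpw r : 0 < r < b0 ->
  h r `^ p * w r = C `^ p * hconf r ^+ n * r ^+ n.-1 * P (hdist r).
Proof.
move=> rb; have k0 := hconf_gt0 (rb1 rb); have gl := goodL rb.
have e1 := eta0 gl; have k1 := ltW k0; have C1 := ltW C0;
  have kC := mulr_ge0 k1 C1.
rewrite /h /w PE// (powRM _ kC e1) (powRM _ k1 C1).
by field; rewrite gt_eqF ?powR_gt0.
Qed.

(** By [qODE] the left-hand side is [dt r] with coth l replaced by 1/l + l conf^(-n). Since (n-1) q
    is nonnegative, [hcoth_ge] concludes. *)
Let dtE r : 0 < r < b0 -> p * (h r `^ p * w r) + e r <= dt r.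
Proof.
move=> rb; have k0 := hconf_gt0 (rb1 rb); have gl := goodL rb.
have /andP[r0 _] := rb.
have L0 := hdist_gt0 (rb1 rb).
have qq := q0 gl.
rewrite hpw// /e /dt QE//.
have -> : C `^ p = C `^ (p - 1) * C.
  by rewrite mulrC mulr_powRB1// ?ltW// (lt_trans ltr01).
rewrite [(r * _) ^+ _]exprMn.
have -> : hconf r ^+ n = hconf r *
  hconf r ^+ n.-1 by rewrite -exprS prednK// (leq_trans _ n2).
set k' := hconf r ^+ n.-1; set r' := r ^+ n.-1; set c := C `^ (p - 1);
  set k := hconf r.
have E1 : (hdist r)^-1 + hdist r * (k * k')^-1 <= (1 + r ^+ 2) / (2 * r).
  rewrite /k /k' -exprS prednK; last by rewrite (leq_trans _ n2).
  by apply: hcoth_ge => //; exact: rb1.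
have k'0 : 0 < k' by rewrite exprn_gt0.
have r'0 : 0 < r' by rewrite exprn_gt0.
have c0 : 0 < c by rewrite powR_gt0.
have -> : p * (c * C * (k * k') * r' * P (hdist r)) +
    (n%:R - 1) * c * r' * (hdist r * q (hdist r)) =
  c * (r' * k') * k * ((n%:R - 1) * ((hdist r)^-1 + hdist r * (k * k')^-1) *
    q (hdist r) + dq (hdist r)).
  have := qODE gl; move=> /(congr1 (fun x => c * k * k' * r' * x)) H.
  have -> : p * (c * C * (k * k') * r' * P (hdist r)) = c * k * k' * r' *
    (p * C * P (hdist r)) by ring.
  rewrite -H; field.
  by rewrite !gt_eqF.
apply: ler_wpM2l.
  exact: (mulr_ge0 (mulr_ge0 (ltW c0) (mulr_ge0 (ltW r'0) (ltW k'0))) (ltW k0)).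
by rewrite lerD2r; apply: ler_wpM2r => //; apply: ler_wpM2l.
Qed.

Local Open Scope ereal_scope.

(** The factor r^(n-1) is kept apart because [ge0_le_integral_polar] compares ray integrals in this
    form. *)
Lemma hardy_radial :
  \int[leb]_(r in `]0%R, b0[) ((r ^+ n.-1)%:E *
     ((C `^ p * (P (hdist r) * hconf r ^+ n) + (n%:R - 1) * C `^ (p - 1) *
       Q (hdist r)) * `|u r| `^ p)%:E)
  <= \int[leb]_(r in `]0%R, b0[) ((r ^+ n.-1)%:E *
     (hconf r ^+ n / hconf r `^ p * wt (hdist r) * `|du r| `^ p)%:E).
Proof.
have mL : measurable_fun (`]0%R, b0[ : set R) (@hdist R).
  apply: open_continuous_measurable_fun; first exact: itv_open.
  by move=> r; rewrite inE/= in_itv/=; exact: hdist_cont.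
have mk : measurable_fun (`]0%R, b0[ : set R) (@hconf R).
  apply: open_continuous_measurable_fun; first exact: itv_open.
  by move=> r; rewrite inE/= in_itv/=; exact: hconf_cont.
have mu : measurable_fun (`]0%R, b0[ : set R) (fun r => `|u r| `^ p)%R.
  apply: (measurableT_comp (@measurable_powR R p)).
  apply: measurableT_comp; first exact: normr_measurable.
  apply: measurable_funTS; apply: continuous_measurable_fun => r.
  by apply: differentiable_continuous; apply/derivable1_diffP;
    have [] := u_der r.
have mdu : measurable_fun (`]0%R, b0[ : set R) (fun r => `|du r| `^ p)%R.
  apply: (measurableT_comp (@measurable_powR R p)).
  apply: measurableT_comp; first exact: normr_measurable.
  by apply: measurable_funTS; apply: continuous_measurable_fun.
have mX (f : R -> R) m : measurable_fun (`]0%R, b0[ : set R) f ->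
    measurable_fun (`]0%R, b0[ : set R) (fun r => f r ^+ m)%R.
  by move=> mf; apply: measurable_realfun.measurable_funX.
have AE r : (0 < r < b0)%R -> ((h r `^ p * w r + e r) * `|u r| `^ p =
   r ^+ n.-1 * ((C `^ p * (P (hdist r) * hconf r ^+ n) + (n%:R - 1) *
     C `^ (p - 1) * Q (hdist r)) * `|u r| `^ p))%R.
  by move=> rb; rewrite hpw// /e; ring.
have DE r : (w r * `|du r| `^ p = r ^+ n.-1 *
     (hconf r ^+ n / hconf r `^ p * wt (hdist r) * `|du r| `^ p))%R.
  by rewrite /w; ring.
have mA' : measurable_fun (`]0%R, b0[ : set R)
  (fun r => r ^+ n.-1 * ((C `^ p * (P (hdist r) * hconf r ^+ n) + (n%:R - 1) *
  C `^ (p - 1) * Q (hdist r)) * `|u r| `^ p))%R.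
  apply: measurable_funM; first exact: mX.
  apply: measurable_funM => //; apply: measurable_funD.
    apply: measurable_funM => //; apply: measurable_funM; last exact: mX.
    exact: measurableT_comp.
  by apply: measurable_funM => //; exact: measurableT_comp.
have mA : measurable_fun (`]0%R, b0[ : set R)
  (fun r => (h r `^ p * w r + e r) * `|u r| `^ p)%R.
  by apply: eq_measurable_fun mA' => r; rewrite inE/= in_itv/= => rb;
    rewrite AE.
have mD : measurable_fun (`]0%R, b0[ : set R) (fun r => w r * `|du r| `^ p)%R.
  apply: measurable_funM => //; apply: measurable_funM; last exact: mX.
  apply: measurable_funM; last exact: measurableT_comp.
  apply: measurable_funM; first exact: mX.
  apply: eq_measurable_fun (measurableT_comp (@measurable_powR R (- p)) mk) => r
    _.
  by rewrite /= powRN.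
have H := @hardy_one_dim R p b b0 u du w h t dt e p1 b_ge0 bb0 u_der du_cont
  u_supp t_der dt_cont w0 h0 e0 tE dtE mA mD.
under eq_integral.
  move=> r; rewrite inE/= in_itv/= => rb; rewrite -EFinM -AE//; over.
under [leRHS]eq_integral do rewrite -EFinM -DE.
exact: H.
Qed.

End radial_hardy.

(** * From rays to the ball *)

Section hardy_ball.
Context (R : realType).
Local Notation leb := (@lebesgue_measure R).
Variables (n : nat) (p C b b0 : R) (wt eta q dq P Q : R -> R)
  (f : 'rV[R]_n -> R).
Hypotheses (n2 : (2 <= n)%N) (p1 : 1 < p) (C0 : 0 < C).
Hypotheses (b_ge0 : 0 <= b) (bb0 : b < b0) (b01 : b0 <= 1).
Hypothesis f_smooth : smooth f.
Hypothesis f_supp : forall x, b < enorm x -> f x = 0.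
Hypotheses (mwt : measurable_fun setT wt) (mP : measurable_fun setT P)
  (mQ : measurable_fun setT Q).
Hypotheses (wt0 : forall l, 0 <= wt l) (P0 : forall l, 0 <= P l)
  (Q0 : forall l, 0 <= Q l).
Let good (l : R) := exists2 r : R, 0 < r < b0 & l = hdist r.
Hypothesis q_der : forall l : R, good l -> is_derive l 1 q (dq l).
Hypothesis dq_cont : forall l : R, good l -> {for l, continuous dq}.
Hypothesis eta0 : forall l, good l -> 0 <= eta l.
Hypothesis qE : forall l, good l -> q l = eta l `^ (p - 1) * wt l.
Hypothesis PE : forall l, good l -> P l = eta l `^ p * wt l.
Hypothesis QE : forall l, good l -> Q l = l * q l.
Hypothesis qODE : forall l, good l -> (n%:R - 1) * (q l / l) + dq l = p * C *
  P l.

Local Notation mu := (rV_lebesgue R n).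
Let Omega : set 'rV[R]_n := [set x | enorm x < b0].

Let mOmega : measurable Omega.
Proof.
have -> : Omega = [set: 'rV[R]_n] `&` @enorm R n @^-1` `]-oo, b0[.
  by apply/seteqP; split => x /=; rewrite in_itv/=; [|case].
by apply: measurable_enorm => //; exact: measurable_itv.
Qed.

Let OmegaB : Omega `<=` @hball R n.
Proof. by move=> x /lt_le_trans; exact. Qed.

Let mrho : measurable_fun Omega (@rho R n).
Proof.
have me : measurable_fun Omega (@enorm R n).
  by apply: measurable_funTS; exact: measurable_enorm.
have H : measurable_fun Omega (fun x : 'rV[R]_n => (1 + enorm x) *
  (1 - enorm x) `^ (-1)).
  apply: measurable_funM; first by apply: measurable_funD => //;
    exact: measurable_cst.
  apply: (measurableT_comp (@measurable_powR R (-1))).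
  by apply: measurable_funB => //; exact: measurable_cst.
apply: eq_measurable_fun (measurableT_comp (@measurable_ln R) H) => x.
rewrite inE => /OmegaB; rewrite /hball/= => x1.
by rewrite powR_inv1// subr_ge0 ltW.
Qed.

Let f_cont : continuous f. Proof. by have [] := f_smooth [::]. Qed.
Let pf_cont i : continuous (partial i f). Proof. by have [] :=
  f_smooth [:: i]. Qed.
Let f_der i x : derivable f x (delta_mx ord0 i).
Proof. by have [_ H] := f_smooth [::]; exact: H. Qed.

(** Cauchy-Schwarz for a unit vector v: with s the inner product of v and the gradient, the squared
    length of grad f - s v is |grad f|^2 - s^2. *)
Let directional_le (v x : 'rV[R]_n) : enorm v = 1 -> `|'D_v f x| <=
  enorm (grad f x).
Proof.
move=> v1; have [_ ->] := derive_C1 f_der pf_cont v.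
set s := \sum_(i < n) _.
have V1 : \sum_(i < n) v ord0 i ^+ 2 = 1.
  by rewrite -[LHS]sqr_sqrtr ?sumr_ge0// => [|i _];
    [rewrite -/(enorm v) v1 expr1n|exact: sqr_ge0].
rewrite -sqrtr_sqr /enorm ler_wsqrtr//.
have -> : \sum_(i < n) grad f x ord0 i ^+ 2 = \sum_(i < n) partial i f x ^+ 2.
  by apply: eq_bigr => i _; rewrite mxE.
rewrite -subr_ge0.
have -> : \sum_(i < n) partial i f x ^+ 2 - s ^+ 2 =
    \sum_(i < n) (partial i f x - s * v ord0 i) ^+ 2.
  transitivity (\sum_(i < n) (partial i f x ^+ 2 - 2 * s *
    (v ord0 i * partial i f x) + s ^+ 2 * v ord0 i ^+ 2)).
    by rewrite big_split /= sumrB -!mulr_sumr V1 -/s; ring.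
  by apply: eq_bigr => i _; ring.
by apply: sumr_ge0 => i _; exact: sqr_ge0.
Qed.

Let mnf : measurable_fun setT (fun x => `|f x| `^ p).
Proof.
apply: (measurableT_comp (@measurable_powR R p)).
apply: measurableT_comp; first exact: normr_measurable.
exact: continuous_rV_measurable.
Qed.

Let mgrad : measurable_fun setT (fun x => enorm (grad f x) `^ p).
Proof.
apply: (measurableT_comp (@measurable_powR R p)).
apply: (measurableT_comp (@measurable_enorm R n)).
apply/measurable_fun_rVP => i.
under [X in measurable_fun _ X]eq_fun do rewrite mxE.
by apply: continuous_rV_measurable; exact: pf_cont.
Qed.

Let mconf : measurable_fun Omega (fun x => conf x ^+ n).
Proof.
apply: measurable_realfun.measurable_funX.
by apply: measurable_funS (@measurable_conf R n) => //; exact: measurable_hball.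
Qed.

Let mconfV : measurable_fun Omega (fun x => (conf x `^ p)^-1).
Proof.
have mc : measurable_fun Omega (@conf R n).
  by apply: measurable_funS (@measurable_conf R n) => //;
    exact: measurable_hball.
apply: eq_measurable_fun (measurableT_comp (@measurable_powR R (- p)) mc) => x
  _.
by rewrite /= powRN.
Qed.

(** [FL] and [FR] are the densities of the two sides with respect to dx: dV_g contributes conf^n,
    and the g-length of the gradient is |grad f| / conf. *)
Let FL x : R := (C `^ p * (P (rho x) * conf x ^+ n) + (n%:R - 1) *
  C `^ (p - 1) * Q (rho x)) * `|f x| `^ p.
Let FR x : R := conf x ^+ n / conf x `^ p * wt (rho x) * enorm (grad f x) `^ p.

Let nn1 : 0 <= n%:R - 1 :> R.
Proof. by rewrite subr_ge0 ler1n (leq_trans _ n2). Qed.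

Let confX0 x : Omega x -> 0 <= conf x ^+ n.
Proof. by move=> /OmegaB xB; rewrite exprn_ge0// conf_ge0. Qed.

Let FL0 x : Omega x -> 0 <= FL x.
Proof.
move=> xO; have c := confX0 xO.
by rewrite mulr_ge0 ?powR_ge0// addr_ge0// !mulr_ge0 ?powR_ge0.
Qed.

Let FR0 x : Omega x -> 0 <= FR x.
Proof. by move=> xO; have c := confX0 xO;
  rewrite !mulr_ge0 ?invr_ge0 ?powR_ge0. Qed.

Let mPr : measurable_fun Omega (fun x => P (rho x)). Proof.
  exact: measurableT_comp. Qed.
Let mQr : measurable_fun Omega (fun x => Q (rho x)). Proof.
  exact: measurableT_comp. Qed.
Let mwr : measurable_fun Omega (fun x => wt (rho x)). Proof.
  exact: measurableT_comp. Qed.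

Let mFL : measurable_fun Omega FL.
Proof.
apply: measurable_funM; last exact: measurable_funTS.
by apply: measurable_funD; apply: measurable_funM => //; apply: measurable_funM.
Qed.

Let mFW (g : 'rV[R]_n -> R) : measurable_fun setT g ->
  measurable_fun Omega (fun x => conf x ^+ n / conf x `^ p * wt (rho x) * g x).
Proof.
move=> mg; apply: measurable_funM; last exact: measurable_funTS.
by apply: measurable_funM => //; apply: measurable_funM.
Qed.

Let mFR : measurable_fun Omega FR. Proof. exact: mFW. Qed.

Let derive_cont (v : 'rV[R]_n) : continuous (fun x => 'D_v f x).
Proof.
rewrite (_ : (fun x => _) = \sum_(i < n) (fun x => v ord0 i * partial i f x));
  last first.
  by apply/funext => x; rewrite fct_sumE (derive_C1 f_der pf_cont v).2.
apply: (big_ind (fun g : 'rV[R]_n -> R => continuous g)).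
- exact: cst_continuous.
- by move=> g h cg ch x; apply: continuousD; [exact: cg|exact: ch].
- by move=> i _ x; apply: continuousM; [exact: cst_continuous|exact: pf_cont].
Qed.

Let mline (v : 'rV[R]_n) (g : 'rV[R]_n -> R) : enorm v = 1 ->
  measurable_fun Omega g ->
  measurable_fun (`]0, b0[ : set (measurableTypeR R)) (fun t => g (t *: v)).
Proof.
move=> v1 mg; apply: (@measurable_comp _ _ _ _ _ _ Omega) => //.
  move=> _ [t /= + <-]; rewrite in_itv/= => /andP[t0 tb].
  by rewrite /Omega/= enormZ v1 mulr1 gtr0_norm.
by apply: measurable_funTS; apply: measurable_rV_scale => //;
  exact: measurable_cst.
Qed.

Local Open Scope ereal_scope.

Let null0 : mu [set 0%R] = 0.
Proof.
have -> : [set 0%R] = [set x : 'rV[R]_n | forall i, [set 0%R] (x ord0 i)].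
  apply/seteqP; split=> x /=; first by move=> -> i; rewrite mxE.
  by move=> H; apply/rowP => i; rewrite H mxE.
rewrite (@rV_lebesgue_box R n (fun=> [set 0%R]))//; case: n n2 => // m _.
by rewrite big_ord_recl lebesgue_measure_set1 mul0e.
Qed.

Let FL_le_FR : \int[mu]_(x in Omega) (FL x)%:E <=
  \int[mu]_(x in Omega) (FR x)%:E.
Proof.
(* The polar comparison wants the left integrand to vanish at 0, where the value of [FL] is
   arbitrary. The origin is a null set and is removed from the domain. *)
rewrite (@ge0_negligible_integral _ _ _ _ Omega [set 0%R])//; last 2 first.
- exact: measurable_rV_set0.
- exact/measurable_EFinP.
rewrite integral_mkcond [leRHS]integral_mkcond.
apply: ge0_le_integral_polar; first by rewrite (leq_trans _ n2).
- apply/(measurable_restrictT _ _).1; first by apply: measurableD => //;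
  exact: measurable_rV_set0.
  by apply/measurable_EFinP; apply: measurable_funS mFL => //; exact: subDsetl.
- by move=> x; apply: erestrict_ge0 => y [yO _]; rewrite lee_fin FL0.
- apply/(measurable_restrictT _ _).1 => //; exact/measurable_EFinP.
- by move=> x; apply: erestrict_ge0 => y yO; rewrite lee_fin FR0.
- move=> v v1.
  have nv (t : R) : (0 < t)%R -> enorm (t *: v)%R = t.
    by move=> t0; rewrite enormZ v1 mulr1 gtr0_norm.
  have v0 (t : R) : (0 < t)%R -> (t *: v)%R != 0%R.
    by move=> t0; rewrite -enorm_eq0 nv// gt_eqF.
  pose u (r : R) := f (r *: v)%R; pose du (r : R) := ('D_v f (r *: v))%R.
  have dv := derive_C1 f_der pf_cont v.
  have u_der (r : R) : is_derive r 1%R u (du r).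
    have := @is_derive_line R n f v 0%R r (dv.1 _).
    by rewrite addr0; under eq_fun do rewrite addr0.
  have du_cont : continuous du.
    move=> r; apply: (@continuous_comp _ _ _ (fun t : R => t *: v)%R
      (fun x => 'D_v f x)).
      exact: scalel_continuous.
    exact: derive_cont.
  have u_supp (r : R) : (b < r)%R -> u r = 0%R.
    by move=> br; apply: f_supp; rewrite nv// (le_lt_trans b_ge0).
  have H := hardy_radial n2 p1 C0 b_ge0 bb0 b01 u_der du_cont u_supp mwt mP mQ
    q_der dq_cont wt0 eta0 qE PE QE qODE.
  have bt0 (t : R) : (b0 <= t)%R -> (0 < t)%R.
    by apply: lt_le_trans; exact: le_lt_trans bb0.
  have EQ (g : 'rV[R]_n -> R) (A : set 'rV[R]_n) :
    (forall t : R, (0 < t < b0)%R -> A (t *: v)%R) ->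
      (forall t : R, (b0 <= t)%R -> ~ A (t *: v)%R) ->
      \int[leb]_(t in `]0%R, +oo[) ((t ^+ n.-1)%:E *
        ((EFin \o g) \_ A) (t *: v)%R) =
      \int[leb]_(t in `]0%R, b0[) ((t ^+ n.-1)%:E * (g (t *: v)%R)%:E).
    move=> A1 A2; rewrite [LHS]integral_mkcond [RHS]integral_mkcond;
      apply: eq_integral => t _.
    rewrite !patchE !mem_setE !in_itv/= andbT; case: (ltP 0%R t) => //= t0.
    case: (ltP t b0) => tb0; first by rewrite mem_set//; apply: A1; rewrite t0.
    by rewrite memNset ?mule0//; exact: A2.
  rewrite (EQ FL); last 2 first.
  - move=> t /andP[t0 tb]; split; first by rewrite /Omega/= nv.
    by move=> /= /eqP; apply/negP; exact: v0.
  - by move=> t bt [+ _]; rewrite /Omega/= (nv _ (bt0 _ bt)) ltNge bt.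
  rewrite (EQ FR); last 2 first.
  - by move=> t /andP[t0 tb]; rewrite /Omega/= nv.
  - by move=> t bt; rewrite /Omega/= (nv _ (bt0 _ bt)) ltNge bt.
  have E (t : R) : (0 < t)%R -> conf (t *: v)%R = hconf t /\ rho (t *: v)%R =
    hdist t.
    by move=> t0; rewrite /conf /rho nv.
  rewrite (_ : \int[leb]_(t in `]0%R, b0[)
    ((t ^+ n.-1)%:E * (FL (t *: v)%R)%:E) =
     \int[leb]_(r in `]0%R, b0[) ((r ^+ n.-1)%:E *
     ((C `^ p * (P (hdist r) * hconf r ^+ n) + (n%:R - 1) * C `^ (p - 1) *
       Q (hdist r)) * `|u r| `^ p)%:E)); last first.
    apply: eq_integral => t; rewrite inE/= in_itv/= => /andP[t0 _].
    by rewrite /FL (E t t0).1 (E t t0).2.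
  (* What remains is to enlarge the derivative along v to the full gradient, by [directional_le]. *)
  apply: le_trans H _.
  have mX : measurable_fun (`]0%R, b0[ : set (measurableTypeR R))
    (fun t : R => (t ^+ n.-1)%:E).
    by apply/measurable_EFinP; apply: measurable_realfun.measurable_funX.
  have X0 (t : R) : (0 < t)%R -> 0 <= (t ^+ n.-1)%:E by move=> t0;
    rewrite lee_fin exprn_ge0// ltW.
  have mD : measurable_fun (`]0%R, b0[ : set (measurableTypeR R)) (fun r =>
      (hconf r ^+ n / hconf r `^ p * wt (hdist r) * `|du r| `^ p)%:E).
    apply/measurable_EFinP.
    have mg : measurable_fun setT (fun x => `|'D_v f x| `^ p)%R.
      apply: (measurableT_comp (@measurable_powR R p)).
      apply: measurableT_comp; first exact: normr_measurable.
      by apply: continuous_rV_measurable; exact: derive_cont.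
    apply: eq_measurable_fun (mline v1 (mFW mg)) => t;
      rewrite inE/= in_itv/= => /andP[t0 _].
    by rewrite /= (E t t0).1 (E t t0).2.
  apply: ge0_le_integral => //.
  - move=> t /=; rewrite in_itv/= => /andP[t0 tb];
    rewrite mule_ge0 ?X0// lee_fin.
    by rewrite -(E t t0).1 !mulr_ge0 ?invr_ge0 ?powR_ge0 ?confX0// /Omega/= nv.
  - exact: emeasurable_funM.
  - by apply: emeasurable_funM => //; apply/measurable_EFinP; exact: mline.
  - move=> t /=; rewrite in_itv/= => /andP[t0 tb]; rewrite lee_wpmul2l ?X0//.
    rewrite lee_fin /FR (E t t0).1 (E t t0).2 ler_wpM2l//.
      by rewrite -(E t t0).1 !mulr_ge0 ?invr_ge0 ?powR_ge0 ?confX0// /Omega/=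
        nv.
    by rewrite ge0_ler_powR ?nnegrE ?enorm_ge0 ?directional_le// ltW//
      (lt_trans ltr01).
- by rewrite patchE memNset// => -[_]; apply.
Qed.

Lemma hardy_ball :
  (C `^ p)%:E * \int[@hvol R n]_(x in Omega) (`|f x| `^ p * P (rho x))%:E +
  ((n%:R - 1) * C `^ (p - 1))%:E *
    \int[mu]_(x in Omega) (`|f x| `^ p * Q (rho x))%:E
  <= \int[@hvol R n]_(x in Omega) (glength x (hgrad f x) `^ p * wt (rho x))%:E.
Proof.
have mfO : measurable_fun Omega (fun x => `|f x| `^ p)%R
  by exact: measurable_funTS.
pose g1 x := (`|f x| `^ p * P (rho x))%R;
  pose g2 x := (`|f x| `^ p * Q (rho x))%R.
have mg1 : measurable_fun Omega g1 by exact: measurable_funM.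
have mg2 : measurable_fun Omega g2 by exact: measurable_funM.
have g10 x : (0 <= g1 x)%R by rewrite mulr_ge0 ?powR_ge0.
have g20 x : (0 <= g2 x)%R by rewrite mulr_ge0 ?powR_ge0.
have g1c0 x : Omega x -> 0 <= (g1 x * conf x ^+ n)%:E.
  by move=> xO; rewrite lee_fin mulr_ge0// confX0.
have mg1c : measurable_fun Omega (fun x => (g1 x * conf x ^+ n)%:E).
  by apply/measurable_EFinP; exact: measurable_funM.
have I1 : \int[@hvol R n]_(x in Omega) (g1 x)%:E =
  \int[mu]_(x in Omega) (g1 x * conf x ^+ n)%:E.
  rewrite (ge0_integral_hvol mOmega OmegaB)//; first exact/measurable_EFinP.
  by move=> x xO; rewrite lee_fin.
have Cp := powR_ge0 C p.
have Cn : (0 <= (n%:R - 1) * C `^ (p - 1))%R by rewrite mulr_ge0 ?powR_ge0.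
change ((C `^ p)%:E * \int[@hvol R n]_(x in Omega) (g1 x)%:E +
  ((n%:R - 1) * C `^ (p - 1))%:E * \int[mu]_(x in Omega) (g2 x)%:E <=
  \int[@hvol R n]_(x in Omega) (glength x (hgrad f x) `^ p * wt (rho x))%:E).
rewrite I1.
rewrite -(ge0_integralZl_EFin mu mOmega g1c0 mg1c Cp).
have mg2' : measurable_fun Omega (fun x => (g2 x)%:E) by exact/measurable_EFinP.
have g20' x : Omega x -> 0 <= (g2 x)%:E by rewrite lee_fin.
rewrite -(ge0_integralZl_EFin mu mOmega g20' mg2' Cn).
rewrite -ge0_integralD//; last 4 first.
- by move=> x xO; rewrite mule_ge0 ?g1c0 ?lee_fin.
- exact: emeasurable_funM.
- by move=> x xO; rewrite mule_ge0 ?g20' ?lee_fin.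
- exact: emeasurable_funM.
have -> : \int[@hvol R n]_(x in Omega)
  (glength x (hgrad f x) `^ p * wt (rho x))%:E =
    \int[mu]_(x in Omega) (FR x)%:E.
  have E x : Omega x -> (glength x (hgrad f x) `^ p =
    enorm (grad f x) `^ p / conf x `^ p)%R.
    move=> /OmegaB xB; have c0 := hball_gt0 xB.
    rewrite glength_hgrad// powRM ?enorm_ge0 ?divr_ge0 ?(ltW c0)// mulrC;
      congr (_ * _)%R.
    rewrite (_ : (1 - enorm x ^+ 2) / 2 = conf x `^ (-1))%R; last first.
      by rewrite powR_inv1 ?conf_ge0// /conf invf_div.
    by rewrite -powRrM mulN1r powRN.
  rewrite (_ : \int[@hvol R n]_(x in Omega) _ = \int[@hvol R n]_(x in Omega)
    (enorm (grad f x) `^ p / conf x `^ p * wt (rho x))%:E); last first.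
    by apply: eq_integral => x; rewrite inE => /E ->.
  have gp0 x : 0 <= (enorm (grad f x) `^ p / conf x `^ p * wt (rho x))%:E.
    by rewrite lee_fin !mulr_ge0 ?invr_ge0 ?powR_ge0.
  rewrite (ge0_integral_hvol mOmega OmegaB); last 2 first.
  - apply/measurable_EFinP; apply: measurable_funM => //.
    by apply: measurable_funM => //; exact: measurable_funTS.
  - by move=> x _; exact: gp0.
  by apply: eq_integral => x _; rewrite -EFinM /FR; congr EFin; ring.
apply: le_trans FL_le_FR; rewrite le_eqVlt; apply/orP; left; apply/eqP.
apply: eq_integral => x _; rewrite -!EFinM -EFinD; congr EFin.
by rewrite /FL /g1 /g2; ring.
Qed.

End hardy_ball.

(** * Radius of the support of a test function *)

Section support_radius.
Context (R : realType) (n : nat).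

Lemma enorm_continuous : continuous (@enorm R n).
Proof.
move=> x; apply: (@continuous_comp _ _ _
  (fun x : 'rV[R]_n => \sum_(i < n) x ord0 i ^+ 2) (@Num.sqrt R)).
  rewrite (_ : (fun x => _) = \sum_(i < n) (fun x : 'rV[R]_n => x ord0 i ^+ 2));
    last first.
    by apply/funext => y; rewrite fct_sumE.
  apply: (big_ind (fun g : 'rV[R]_n -> R => {for x, continuous g})).
  - exact: cst_continuous.
  - by move=> g h cg ch; apply: continuousD; [exact: cg|exact: ch].
  - move=> i _; apply: (@continuous_comp _ _ _ (fun x : 'rV[R]_n => x ord0 i)
    (fun t => t ^+ 2)).
      exact: coord_continuous.
    exact: exprn_continuous.
exact: sqrt_continuous.
Qed.

(** The norm attains its maximum on the compact support at a point of Omega, so that maximum is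
    strictly below b0. This gap is what the choice of [b1] relies on. An empty support is served by
    radius 0. *)
Lemma test_function_radius (Omega : set 'rV[R]_n) (f : 'rV[R]_n -> R) (b0 : R) :
  0 < b0 -> Omega `<=` [set x | enorm x < b0] -> test_function Omega f ->
  exists b, [/\ 0 <= b, b < b0 & forall x, b < enorm x -> f x = 0].
Proof.
move=> b00 sub [_ cK KO]; set K := closure _ in cK KO.
have fK x : f x != 0 -> K x by move=> fx; exact: subset_closure.
have [K0|/set0P[y Ky]] := eqVneq K set0.
  exists 0; split=> // x _; apply/eqP/negPn/negP => /fK; by rewrite K0.
have [c Kc cmax] := EVT_max_rV (ex_intro _ y Ky) cK
  (continuous_subspaceT enorm_continuous).
rewrite inE in Kc; exists (enorm c); split; first exact: enorm_ge0.
- exact/sub/KO.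
- move=> x cx; apply/eqP/negPn/negP => /fK Kx.
  by have := cmax x; rewrite inE => /(_ Kx); rewrite leNgt cx.
Qed.

End support_radius.

(** * Real powers and logarithms of positive numbers *)

Section powers.
Context (R : realType).
Implicit Types x a : R.

Lemma powRV x a : 0 <= x -> x^-1 `^ a = (x `^ a)^-1.
Proof. by move=> x0; rewrite -powR_inv1// -powRrM mulN1r powRN. Qed.

Lemma powR_gt0B x a c : 0 < x -> x `^ (a - c) = x `^ a / x `^ c.
Proof. by move=> x0; rewrite powRB// (gt_eqF x0) implybT. Qed.

Lemma powR_gt0D x a c : 0 < x -> x `^ (a + c) = x `^ a * x `^ c.
Proof. by move=> x0; rewrite powRD// (gt_eqF x0) implybT. Qed.

Lemma powR_continuous a x : 0 < x -> {for x, continuous (@powR R ^~ a)}.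
Proof.
move=> x0; apply: differentiable_continuous; apply/derivable1_diffP.
by have [] := is_derive1_powR a x0.
Qed.

Lemma ln_gt0_continuous x : 0 < x -> {for x, continuous (@ln R)}.
Proof.
move=> x0; apply: differentiable_continuous; apply/derivable1_diffP.
by have [] := is_derive1_ln x0.
Qed.

Lemma measurable_powRV a : measurable_fun setT (fun x => (x `^ a)^-1).
Proof.
by under eq_fun do rewrite -powRN; exact: measurable_powR.
Qed.

End powers.

Theorem theorem5p1 (R : realType) (n : nat) (hn : (2 <= n)%N) :
  (forall p beta : R, 1 < p -> p < n%:R -> beta < n%:R - p ->
    exists c : R, 0 < c /\
      forall f : 'rV[R]_n -> R, test_function (@hball R n) f ->
        (((((n%:R - p - beta) / p) `^ p)%:E *
            \int[@hvol R n]_(x in @hball R n)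
              (`|f x| `^ p / rho x `^ (p + beta))%:E
          + (3 * c * (n%:R - 1) * ((n%:R - p - beta) / p) `^ (p - 1))%:E *
            \int[rV_lebesgue R n]_(x in @hball R n)
              (`|f x| `^ p / rho x `^ (p + beta - 2))%:E)%E
         <= \int[@hvol R n]_(x in @hball R n)
              (glength x (hgrad f x) `^ p / rho x `^ beta)%:E)%E)
  /\
  (exists c : R, 0 < c /\
    forall p : R, 1 < p ->
      forall f : 'rV[R]_n -> R, test_function (@hball1 R n) f ->
        (((((p - 1) / p) `^ p)%:E *
            \int[@hvol R n]_(x in @hball1 R n)
              (`|f x| `^ p / (rho x `^ n%:R * ln (1 / rho x) `^ p))%:E
          + (3 * c * (n%:R - 1) * ((p - 1) / p) `^ (p - 1))%:E *
            \int[rV_lebesgue R n]_(x in @hball1 R n)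
              (`|f x| `^ p /
                (rho x `^ (n%:R - 2) * ln (1 / rho x) `^ (p - 1)))%:E)%E
         <= \int[@hvol R n]_(x in @hball1 R n)
              (glength x (hgrad f x) `^ p / rho x `^ (n%:R - p))%:E)%E).
Proof.
split=> [p beta p1 pn betan|].
  exists 3^-1; split=> [|f tf]; first by rewrite invr_gt0.
  have [b [b_ge0 b1 f_supp]] := test_function_radius ltr01 (fun x h => h) tf.
  have p0 : 0 < p by lra.
  have C0 : 0 < (n%:R - p - beta) / p by rewrite divr_gt0//; lra.
  rewrite mulfV// mul1r.
  (* Here b0 = 1 and eta = 1/l. The equation for q holds because (n-1) + (1-p-beta) = n-p-beta = p
     C. *)
  apply: (@hardy_ball R n p _ b 1 (fun l => (l `^ beta)^-1) (fun l => l^-1)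
    (fun l => l `^ (1 - p - beta))
      (fun l => (1 - p - beta) * l `^ (1 - p - beta - 1))
    (fun l => (l `^ (p + beta))^-1) (fun l => (l `^ (p + beta - 2))^-1) f hn p1
      C0
    b_ge0 b1 (lexx 1)); rewrite ?ler01//.
  - by case: tf.
  - exact: measurable_powRV.
  - exact: measurable_powRV.
  - exact: measurable_powRV.
  - by move=> l; rewrite invr_ge0 powR_ge0.
  - by move=> l; rewrite invr_ge0 powR_ge0.
  - by move=> l; rewrite invr_ge0 powR_ge0.
  - by move=> l [r /hdist_gt0 l0 ->]; exact: is_derive1_powR.
  - move=> l [r /hdist_gt0 l0 ->]; apply: continuousM;
    first exact: cst_continuous.
    exact: powR_continuous.
  - by move=> l [r /hdist_gt0 l0 ->]; rewrite invr_ge0 ltW.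
  - move=> l [r /hdist_gt0 l0 ->]; rewrite powRV ?ltW// !powR_gt0B//; field.
    by rewrite !gt_eqF ?powR_gt0.
  - move=> l [r /hdist_gt0 l0 ->]; rewrite powRV ?ltW// powR_gt0D//; field.
    by rewrite !gt_eqF ?powR_gt0.
  - move=> l [r /hdist_gt0 l0 ->];
    rewrite !powR_gt0B// !powR_gt0D// !powRr1 ?ltW//; field.
    by rewrite !gt_eqF ?powR_gt0.
  - move=> l [r /hdist_gt0 l0 ->];
    rewrite !powR_gt0B// !powR_gt0D// powRr1 ?ltW//; field.
    by rewrite !gt_eqF ?powR_gt0.
exists 3^-1; split=> [|p p1 f tf]; first by rewrite invr_gt0.
(* Makes the number e an opaque variable for [lra], which needs only e > 1. *)
have [e eE] : exists e : R, e = expR 1 by eexists.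
have e1 : 1 < e by rewrite eE -[ltLHS]expR0 ltr_expR.
(* The solution of [hdist r = 1], that is tanh(1/2): the Euclidean radius of the geodesic unit
   ball. *)
pose b0 : R := (e - 1) / (e + 1).
have ep : 0 < e + 1 by lra.
have b00 : 0 < b0 by rewrite divr_gt0//; lra.
have b01 : b0 < 1 by rewrite ltr_pdivrMr//; lra.
have hlt r : 0 <= r -> r < 1 -> (hdist r < 1) = (r < b0).
  move=> r0 r1; rewrite /hdist -[X in (_ < X) = _](expRK 1) ltr_ln ?posrE
    ?expR_gt0//; last first.
    by rewrite divr_gt0//; lra.
  rewrite -eE ltr_pdivrMr ?subr_gt0// ltr_pdivlMr//.
  by apply/idP/idP; lra.
have BE : @hball1 R n = [set x | enorm x < b0].
  apply/seteqP; split=> x /=.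
    by move=> [xB]; rewrite -[rho x]/(hdist (enorm x)) hlt ?enorm_ge0.
  move=> xb; have xB : enorm x < 1 by exact: lt_trans b01.
  by split=> //; rewrite -[rho x]/(hdist (enorm x)) hlt ?enorm_ge0.
have [b [b_ge0 bb0 f_supp]] : exists b,
  [/\ 0 <= b, b < b0 & forall x, b < enorm x -> f x = 0].
  by apply: test_function_radius tf => //; rewrite BE.
have p0 : 0 < p by lra.
have C0 : 0 < (p - 1) / p by rewrite divr_gt0//; lra.
have good l : (exists2 r : R, 0 < r < b0 & l = hdist r) -> 0 < l /\ 0 < - ln l.
  move=> [r /andP[r0 rb] ->].
  have r1 : 0 < r < 1 by rewrite r0 (lt_trans rb).
  have l0 := hdist_gt0 r1; split=> //.
  by rewrite oppr_gt0 ln_lt0// l0 hlt//; lra.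
(* Valid for every real l because [ln] is 0 on nonpositive numbers; the measurability of the weights
   is required on the whole line. *)
have lnV' (l : R) : ln (1 / l) = - ln l.
  rewrite div1r; have [l0|l0] := ltP 0 l; first by rewrite lnV.
  by rewrite !ln0 ?oppr0// invr_le0.
have mM a : measurable_fun setT (fun l : R => (ln (1 / l) `^ a)^-1).
  under eq_fun do rewrite lnV'; apply: (measurableT_comp (measurable_powRV a)).
  by apply: measurable_funN; exact: measurable_ln.
rewrite mulfV// mul1r BE.
(* With M = ln(1/l) and eta = 1/(l M), the derivative of l^(1-n) cancels the term (n-1) q / l. Only
   the derivative of M^(1-p) survives, giving (p-1) l^(-n) M^(-p) = p C P. *)
apply: (@hardy_ball R n p _ b b0 (fun l => (l `^ (n%:R - p))^-1)
  (fun l => (l * - ln l)^-1)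
    (fun l => l `^ (1 - n%:R) * (- ln l) `^ (1 - p))
    (fun l => l `^ (1 - n%:R) * ((1 - p) * (- ln l) `^ (1 - p - 1) * - l^-1) +
      (- ln l) `^ (1 - p) * ((1 - n%:R) * l `^ (1 - n%:R - 1)))
    (fun l => (l `^ n%:R * ln (1 / l) `^ p)^-1)
    (fun l => (l `^ (n%:R - 2) * ln (1 / l) `^ (p - 1))^-1) f hn p1 C0
    b_ge0 bb0 (ltW b01)) => //.
- by case: tf.
- exact: measurable_powRV.
- under eq_fun do rewrite invfM.
  by apply: measurable_funM; [exact: measurable_powRV|exact: mM].
- under eq_fun do rewrite invfM.
  by apply: measurable_funM; [exact: measurable_powRV|exact: mM].
- by move=> l; rewrite invr_ge0 powR_ge0.
- by move=> l; rewrite invr_ge0 mulr_ge0 ?powR_ge0.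
- by move=> l; rewrite invr_ge0 mulr_ge0 ?powR_ge0.
- move=> l /good[l0 M0].
  have H1 := is_derive1_powR (1 - n%:R) l0.
  have H2 : is_derive l 1 (fun x : R => - ln x) (- l^-1).
    have H := is_derive1_ln l0; exact: is_deriveN.
  have H3 := @is_derive1_comp R (@powR R ^~ (1 - p)) (fun x : R => - ln x) l _ _
    (is_derive1_powR (1 - p) M0) H2.
  exact: (@is_deriveM R _ _ _ l 1 _ _ H1 H3).
- move=> l /good[l0 M0].
  have cM a : {for l, continuous (fun x : R => (- ln x) `^ a)}.
    apply: (@continuous_comp _ _ _ (fun x : R => - ln x) (@powR R ^~ a)).
      by apply: continuousN; exact: ln_gt0_continuous.
    exact: powR_continuous.
  have cl a : {for l, continuous (@powR R ^~ a)} by exact: powR_continuous.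
  apply: continuousD; apply: continuousM => //.
    apply: continuousM; first by apply: continuousM => //;
      exact: cst_continuous.
    by apply: continuousN; apply: continuousV => //; rewrite gt_eqF.
  by apply: continuousM => //; exact: cst_continuous.
- by move=> l /good[l0 M0]; rewrite invr_ge0 mulr_ge0 ?ltW.
- move=> l /good[l0]; move: (- ln l) => M M0.
  rewrite powRV ?mulr_ge0 ?(ltW l0) ?(ltW M0)// powRM ?(ltW l0) ?(ltW M0)//
    !powR_gt0B// !powRr1 ?ltW//.
  by field; rewrite !gt_eqF ?powR_gt0.
- move=> l /good[l0]; rewrite lnV'; move: (- ln l) => M M0.
  rewrite powRV ?mulr_ge0 ?(ltW l0) ?(ltW M0)// powRM ?(ltW l0) ?(ltW M0)//
    !powR_gt0B//.
  by field; rewrite !gt_eqF ?powR_gt0.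
- move=> l /good[l0]; rewrite lnV'; move: (- ln l) => M M0;
  rewrite !powR_gt0B// (@powR_mulrn _ _ 2) ?ltW// !powRr1 ?ltW//.
  by field; rewrite !gt_eqF ?powR_gt0.
- move=> l /good[l0]; rewrite lnV'; move: (- ln l) => M M0;
  rewrite !powR_gt0B// !powRr1 ?ltW//.
  by field; rewrite !gt_eqF ?powR_gt0.
Qed.
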